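(* Let $G$ be a compact Hausdorff topological group. Let $\underline{X}=\{X_i,p_i^j\}$ be an inverse sequence (indexed by $i\in\mathbb{N}$) of completely metrizable $G$-spaces and $G$-maps, and let $X=\varprojlim \underline{X}$ be its inverse limit. Assume that each $X_i$ is a $G$-ANR and every bonding map $p_i^{i+1}:X_{i+1}\to X_i$ is a fine $G$-homotopy equivalence. Then $X$ is a $G$-ANR. Moreover, if every $X_i$ is a $G$-AR, then $X$ is also a $G$-AR.
   Context: $G$ is a compact Hausdorff topological group. All spaces are completely regular and Hausdorff, and all maps are continuous. A $G$-space is a space with a continuous action of $G$; a $G$-map is a continuous map $f$ with $f(gx)=gf(x)$ for all $g\in G$ and all $x$. A subset $S$ of a $G$-space is invariant if $gs\in S$ for all $g\in G$, $s\in S$. A (completely) metrizable $G$-space is a $G$-space whose underlying space is (completely) metrizable. $G$-ANR and $G$-AR: a metrizable $G$-space $Y$ is a $G$-ANR if for every closed $G$-embedding $Y\hookrightarrow Z$ in a metrizable $G$-space $Z$ there exist an invariant neighborhood $U$ of $Y$ in $Z$ and a $G$-retraction $r:U\to Y$ (i.e. a $G$-map that is the identity on $Y$). If one can always take $U=Z$, then $Y$ is a $G$-AR. $G$-homotopy: with $I=[0,1]$, a $G$-homotopy is a continuous map $F:X\times I\to Y$ that is a $G$-map for the action $g(x,t)=(gx,t)$ on $X\times I$; write $F_t(x)=F(x,t)$. Given an open cover $\mathcal{U}$ of $Y$, a $G$-$\mathcal{U}$-homotopy is a $G$-homotopy $F:X\times I\to Y$ such that for every $x\in X$ there is $U\in\mathcal{U}$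 with $F_t(x)\in U$ for all $t\in I$; then $F_0$ and $F_1$ are called $G$-$\mathcal{U}$-homotopic. For a map $f:X\to Y$ and an open cover $\mathcal{U}$ of $Y$, $f^{-1}(\mathcal{U})=\{f^{-1}(U)\mid U\in\mathcal{U}\}$, an open cover of $X$. A $G$-map $f:X\to Y$ is a fine $G$-homotopy equivalence if for every open cover $\mathcal{U}$ of $Y$ there is a $G$-map $\varphi:Y\to X$ such that $\varphi f$ is $G$-$f^{-1}(\mathcal{U})$-homotopic to $\mathrm{id}_X$ and $f\varphi$ is $G$-$\mathcal{U}$-homotopic to $\mathrm{id}_Y$. Inverse sequence and inverse limit: an inverse sequence $\underline{X}=\{X_i,p_i^j\}$ consists of $G$-spaces $X_i$, $i\in\mathbb{N}$, and $G$-maps (bonding maps) $p_i^j:X_j\to X_i$ for $i\le j$, with $p_j^j=\mathrm{id}_{X_j}$ and $p_i^j\circ p_j^k=p_i^k$ for $i\le j\le k$. Its inverse limit is $\varprojlim\underline{X}=\{x\in\prod_{i\in\mathbb{N}}X_i\mid p_i(x)=p_i^j(p_j(x)) \text{ for all } i\le j\}$, where $p_j$ is the projection onto the $j$-th factor, with the topology induced from the product and the diagonal action of $G$. *)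

(* Defs.v *)
From HB Require Import structures.
From mathcomp Require Import all_boot all_order all_algebra.
From mathcomp Require Import all_classical all_reals all_analysis.
Set Implicit Arguments.
Unset Strict Implicit.
Unset Printing Implicit Defensive.
Import Order.TTheory GRing.Theory Num.Theory.
Import numFieldNormedType.Exports.
Local Open Scope classical_set_scope.
Local Open Scope ring_scope.

HB.mixin Record isTopologicalGroup G & Topological G & Group G := {
  mulg_continuous : continuous (fun p : G * G => (p.1 * p.2)%g) ;
  invg_continuous : continuous (fun x : G => (x^-1)%g)
}.

#[short(type="topGroupType")]
HB.structure Definition TopologicalGroup :=
  {G of Topological G & Group G & isTopologicalGroup G}.

HB.mixin Record isGSpace (G : topGroupType) X & Topological X := {
  gact : G -> X -> X ;
  gact1 : forall x, gact 1%g x = x ;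
  gactM : forall g h x, gact (g * h)%g x = gact g (gact h x) ;
  gact_continuous : continuous (fun p : G * X => gact p.1 p.2)
}.

#[short(type="gspaceType")]
HB.structure Definition GSpace (G : topGroupType) :=
  {X of Topological X & isGSpace G X}.

Definition gmap (G : topGroupType) (X Y : gspaceType G) (f : X -> Y) :=
  continuous f /\ forall (g : G) x, f (gact g x) = gact g (f x).

Definition invariant (G : topGroupType) (X : gspaceType G) (S : set X) :=
  forall (g : G) x, S x -> S (gact g x).

(* The proof of invariance is a phantom argument, so that the restricted action
   can be attached to [subG] canonically. *)
Definition subG (G : topGroupType) (X : gspaceType G) (S : set X)
  of invariant S : Type := set_type S.

Section subG_instances.
Context (G : topGroupType) (X : gspaceType G) (S : set X) (iS : invariant S).

HB.instance Definition _ := Topological.copy (subG iS) (set_type S).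

Definition subG_val (u : subG iS) : X := @set_val X S u.

Definition subG_act (g : G) (u : subG iS) : subG iS :=
  exist _ (gact g (subG_val u)) (mem_set (iS g (set_valP (u : set_type S)))).

Lemma subG_val_inj : injective subG_val.
Proof. exact: val_inj. Qed.

Lemma subG_val_continuous : continuous subG_val.
Proof. exact: initial_continuous. Qed.

Fact subG_act1 u : subG_act 1%g u = u.
Proof. by apply: subG_val_inj; exact: gact1. Qed.

Fact subG_actM g h u : subG_act (g * h)%g u = subG_act g (subG_act h u).
Proof. by apply: subG_val_inj; exact: gactM. Qed.

Fact subG_act_continuous :
  continuous (fun p : G * subG iS => subG_act p.1 p.2).
Proof.
apply/continuousP => _ [B oB <-].
have c : continuous (fun p : G * subG iS => gact p.1 (subG_val p.2)).
  move=> p; apply: (@continuous_comp _ _ _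
    (fun p : G * subG iS => (p.1, subG_val p.2)) (fun q => gact q.1 q.2)).
    by apply: cvg_pair; [exact: cvg_fst |
      apply: continuous_comp; [exact: cvg_snd|exact: subG_val_continuous]].
  exact: gact_continuous.
by move/continuousP: c => /(_ _ oB).
Qed.

HB.instance Definition _ :=
  isGSpace.Build G (subG iS) subG_act1 subG_actM subG_act_continuous.
End subG_instances.

Section product_instances.
Context (G : topGroupType) (I : eqType) (X : I -> gspaceType G).

Definition prod_act (g : G) (x : prod_topology X) : prod_topology X :=
  fun i => gact g (x i).

Fact prod_act1 x : prod_act 1%g x = x.
Proof. by apply: functional_extensionality_dep => i; exact: gact1. Qed.

Fact prod_actM g h x : prod_act (g * h)%g x = prod_act g (prod_act h x).
Proof. by apply: functional_extensionality_dep => i; exact: gactM. Qed.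

Fact prod_act_continuous :
  continuous (fun p : G * prod_topology X => prod_act p.1 p.2).
Proof.
move=> p; apply/cvg_sup => i.
move=> A [B [[C oC <-] Cp CA]]; apply: (filterS CA) => /=.
have c : {for p, continuous
    (fun q : G * prod_topology X => gact q.1 (q.2 i) : X i)}.
  apply: (@continuous_comp _ _ _ (fun q : G * prod_topology X => (q.1, q.2 i))
    (fun q => gact q.1 q.2)); last exact: gact_continuous.
  apply: cvg_pair; first exact: cvg_fst.
  apply: (@continuous_comp _ (prod_topology X) _ snd (@proj I X i)).
    exact: cvg_snd.
  exact: (@proj_continuous I (fun i => X i : topologicalType) i).
by apply: c; exact: open_nbhs_nbhs.
Qed.

HB.instance Definition _ := isGSpace.Build G (prod_topology X)
  prod_act1 prod_actM prod_act_continuous.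
End product_instances.

Definition metrizable (R : realType) (X : topologicalType) :=
  exists m : @Metric.axioms_ R X, let M := Metric.Pack m in
    forall x : X, @nbhs X X x = @nbhs M M x.

(* The library's [completeType] requires a point, whence the explicit
   convergence of Cauchy filters: spaces may be empty here. *)
Definition completely_metrizable (R : realType) (X : topologicalType) :=
  exists m : @Metric.axioms_ R X, let M := Metric.Pack m in
    (forall x : X, @nbhs X X x = @nbhs M M x) /\
    (forall F : set_system M, ProperFilter F -> cauchy F ->
       exists x : M, F --> x).

Definition closed_gembedding (G : topGroupType) (Y Z : gspaceType G)
    (i : Y -> Z) :=
  [/\ gmap i, injective i, @open Y = [set i @^-1` B | B in @open Z] &
      closed (range i)].

(* [Y] is identified with its image under [i]: a retraction onto [Y] is a G-map
   into [Y] with [r (i y) = y]. Its domain is the subspace [U] itself, not all of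
   [Z], since [Y] and [U] may be empty while [Z] is not. *)
Definition G_ANR (R : realType) (G : topGroupType) (Y : gspaceType G) :=
  metrizable R Y /\
  forall (Z : gspaceType G) (i : Y -> Z),
    metrizable R Z -> closed_gembedding i ->
    exists (U : set Z) (iU : invariant U) (r : subG iU -> Y),
      [/\ range i `<=` U°, gmap r &
          forall y u, subG_val u = i y -> r u = y].

Definition G_AR (R : realType) (G : topGroupType) (Y : gspaceType G) :=
  metrizable R Y /\
  forall (Z : gspaceType G) (i : Y -> Z),
    metrizable R Z -> closed_gembedding i ->
    exists r : Z -> Y, gmap r /\ forall y, r (i y) = y.

Definition unit_itv (R : realType) : set R := `[0, 1].

Fact unit_itv0_subproof (R : realType) : (0 : R) \in @unit_itv R.
Proof. by rewrite mem_setE /= in_itv /= lexx ler01. Qed.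

Fact unit_itv1_subproof (R : realType) : (1 : R) \in @unit_itv R.
Proof. by rewrite mem_setE /= in_itv /= ler01 lexx. Qed.

Definition unit_itv0 (R : realType) : set_type (@unit_itv R) :=
  exist _ 0 (unit_itv0_subproof R).

Definition unit_itv1 (R : realType) : set_type (@unit_itv R) :=
  exist _ 1 (unit_itv1_subproof R).

Definition open_cover (Y : topologicalType) (U : set (set Y)) :=
  (forall A, U A -> open A) /\ \bigcup_(A in U) A = setT.

Definition preimage_cover (X Y : Type) (f : X -> Y) (U : set (set Y)) :
  set (set X) := [set f @^-1` A | A in U].

Definition ghomotopy (R : realType) (G : topGroupType) (X Y : gspaceType G)
    (F : X * set_type (@unit_itv R) -> Y) :=
  continuous F /\ forall (g : G) x t, F (gact g x, t) = gact g (F (x, t)).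

(* [f0] and [f1] are G-[U]-homotopic. *)
Definition ghomotopic_within (R : realType) (G : topGroupType)
    (X Y : gspaceType G) (U : set (set Y)) (f0 f1 : X -> Y) :=
  exists F : X * set_type (@unit_itv R) -> Y,
    [/\ ghomotopy F,
        forall x, exists2 A, U A & forall t, A (F (x, t)),
        forall x, F (x, unit_itv0 R) = f0 x &
        forall x, F (x, unit_itv1 R) = f1 x].

Definition fine_ghomotopy_equivalence (R : realType) (G : topGroupType)
    (X Y : gspaceType G) (f : X -> Y) :=
  gmap f /\
  forall U : set (set Y), open_cover U ->
    exists phi : Y -> X,
      [/\ gmap phi,
          ghomotopic_within R (preimage_cover f U) (phi \o f) id &
          ghomotopic_within R U (f \o phi) id].

Record inverse_sequence (G : topGroupType) := InverseSequence {
  inv_obj :> nat -> gspaceType G ;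
  bond : forall i j, (i <= j)%N -> inv_obj j -> inv_obj i ;
  bond_gmap : forall i j (ij : (i <= j)%N), gmap (bond ij) ;
  bond_id : forall i x, bond (leqnn i) x = x ;
  bond_comp : forall i j k (ij : (i <= j)%N) (jk : (j <= k)%N) x,
    bond ij (bond jk x) = bond (leq_trans ij jk) x
}.
Arguments bond {G} X {i j} ij x : rename.

Section inverse_limit.
Context (G : topGroupType) (X : inverse_sequence G).

Definition threads : set (prod_topology (fun i => X i)) :=
  [set x | forall i j (ij : (i <= j)%N), x i = bond X ij (x j)].

Lemma threads_invariant : invariant threads.
Proof.
by move=> g x tx i j ij; rewrite (bond_gmap X ij).2 -(tx i j ij).
Qed.

Definition invlim : gspaceType G := subG threads_invariant.
End inverse_limit.

(* Main.v *)
(* Every $G$-space in sight carries a bounded $G$-invariant metric, obtained by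
   taking suprema over the compact group. A $G$-ANR [Y] then extends $G$-maps
   [f : B -> Y] from closed invariant [B] in [Z] to neighborhoods: glue [Y] to
   [Z] along [f] by sending [y] to its distance function [dY y], and a point [z]
   off [B] to [inf_a (dY (f a) + d(z, a) / d(z, B) - 1)], in the space of bounded
   functions on [Y] with the supremum metric (a further coordinate records
   [d(z, B)]). This is equivariant as it stands, so that no averaging over [G]
   is needed. A controlled Borsuk homotopy extension follows.

   Let the limit be closed in [Z]. Its projection to [X_0] extends to a $G$-map
   [s_0] on a neighborhood. Given an extension [s_i] of the projection to [X_i],
   a fine homotopy inverse [phi] of the bonding map makes [phi \o s_i] homotopic
   on the limit to the projection to [X_(i+1)]; homotopy extension turns it into
   an extension [s_(i+1)], on the same domain, lifting [s_i] up to [2^-i]. By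
   completeness the images of the [s_j] in [X_i] converge, and the limits form a
   $G$-retraction. *)
Require Import Defs.
From HB Require Import structures.
From mathcomp Require Import all_boot all_order all_algebra.
From mathcomp Require Import all_classical all_reals all_analysis.
From mathcomp Require Import lra.
Set Implicit Arguments.
Unset Strict Implicit.
Unset Printing Implicit Defensive.
Import Order.TTheory GRing.Theory Num.Theory.
Import numFieldNormedType.Exports.
Local Open Scope classical_set_scope.
Local Open Scope ring_scope.

(** * Invariant metrics *)

(** The bound by [1] makes the suprema below exist and lets [1] stand in for an infimum over the
    empty set. A predicate on a plain function, tied to the topology by [gm_nbhs], leaves the
    topology of [X] as it is. *)
Record gmetric (R : realType) (G : topGroupType) (X : gspaceType G)
    (d : X -> X -> R) : Prop := GMetric {
  gm_ge0 : forall x y, 0 <= d x y ;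
  gm_le1 : forall x y, d x y <= 1 ;
  gm_xx : forall x, d x x = 0 ;
  gm_eq : forall x y, d x y = 0 -> x = y ;
  gm_sym : forall x y, d x y = d y x ;
  gm_tri : forall y x z, d x z <= d x y + d y z ;
  gm_inv : forall (g : G) x y, d (gact g x) (gact g y) = d x y ;
  gm_nbhs : forall x A,
    nbhs x A <-> exists2 e : R, 0 < e & forall y, d x y < e -> A y }.

Section gact_theory.
Context (G : topGroupType) (X : gspaceType G).

Lemma gactK (g : G) : cancel (@gact G X g) (gact (g^-1)%g).
Proof. by move=> x; rewrite -gactM mulVg gact1. Qed.

Lemma gactVK (g : G) : cancel (@gact G X (g^-1)%g) (gact g).
Proof. by move=> x; rewrite -gactM mulgV gact1. Qed.

Lemma gact_near (g : G) (x : X) (A : set X) : nbhs (gact g x) A ->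
  \forall h \near g & y \near x, A (gact h y).
Proof. by move=> nA; exact: (@gact_continuous G X (g, x) A nA). Qed.

Lemma gact_cts (g : G) : continuous (@gact G X g).
Proof.
move=> x A /gact_near [[P Q]/= [nP nQ] PQ].
by apply: filterS nQ => y Qy; apply: (PQ (g, y)); split=> //; exact: nbhs_singleton.
Qed.

Lemma orbit_cts (x : X) : continuous (fun g : G => gact g x).
Proof.
move=> g A /gact_near [[P Q]/= [nP nQ] PQ].
by apply: filterS nP => h Ph; apply: (PQ (h, x)); split=> //; exact: nbhs_singleton.
Qed.

Lemma orbit_near (x : X) (g : G) (A : set X) :
  nbhs (gact g x) A -> \forall h \near g, A (gact h x).
Proof. exact: orbit_cts. Qed.

End gact_theory.

Section invariant_metric.
Context (R : realType) (G : topGroupType) (X : gspaceType G).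
Context (cptG : compact [set: G]) (m : Metric.axioms_ R X).
Let M := Metric.Pack m.
Context (nbhsM : forall x : X, @nbhs X X x = @nbhs M M x).

Let d0 (x y : X) : R := Num.min 1 (mdist (x : M) (y : M)).
Let D x y := [set d0 (gact g x) (gact g y) | g in [set: G]].
Let d x y := sup (D x y).

Let d0_ge0 x y : 0 <= d0 x y.
Proof. by rewrite le_min ler01 mdist_ge0. Qed.

Let d0_le1 x y : d0 x y <= 1.
Proof. by rewrite ge_min lexx. Qed.

Let d0_tri y x z : d0 x z <= d0 x y + d0 y z.
Proof.
have := metric_triangle (x : M) y z; have := mdist_ge0 (x : M) y.
have := mdist_ge0 (y : M) z.
rewrite /d0 !minEle; do 3 case: ifP; move=> *; lra.
Qed.

Let d0_near (x : X) (e : R) : 0 < e -> \forall y \near x, d0 x y < e.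
Proof.
move=> e0; suff: nbhs x [set y | d0 x y < e] by [].
rewrite nbhsM; have := nbhsx_ballx (x : M) e e0.
by apply: filterS => y; rewrite ballEmdist /= /d0 gt_min => ->; rewrite orbT.
Qed.

Let le_d (g : G) x y : d0 (gact g x) (gact g y) <= d x y.
Proof.
apply: ub_le_sup; last by exists g.
by exists 1 => _ [h _ <-].
Qed.

Let d_le x y (c : R) : (forall g, d0 (gact g x) (gact g y) <= c) -> d x y <= c.
Proof.
move=> h; apply: ge_sup => [|_ [g _ <-]//].
by exists (d0 (gact 1%g x) (gact 1%g y)), 1%g.
Qed.

Let le_d1 x y : d0 x y <= d x y.
Proof. by have := le_d 1%g x y; rewrite !gact1. Qed.

(** The witness is the supremum over [G] of the translates of the metric truncated at [1];
    compactness of [G] keeps its topology unchanged. The domination clause is what carries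
    completeness over. *)
Lemma gmetric_of_metric : exists d : X -> X -> R,
  gmetric d /\ forall x y, Num.min 1 (mdist (x : M) (y : M)) <= d x y.
Proof.
exists d; split; last exact: le_d1.
have d_sym x y : d x y = d y x.
  by congr sup; apply/seteqP; split=> _ [g _ <-]; exists g => //;
    rewrite /d0 metric_sym.
have inv_le (g : G) x y : d (gact g x) (gact g y) <= d x y.
  by apply: d_le => h; rewrite -!gactM.
split.
- by move=> x y; exact: le_trans (le_d1 x y).
- by move=> x y; exact: d_le.
- move=> x; apply/eqP; rewrite eq_le (le_trans _ (le_d1 x x))// andbT.
  by apply: d_le => g; rewrite /d0 mdistxx ge_min lexx orbT.
- move=> x y dxy; apply: (@mdist_positivity _ M).
  have := le_d1 x y; rewrite dxy /d0 ge_min ler10 /= => le0.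
  by apply/eqP; rewrite eq_le le0 mdist_ge0.
- exact: d_sym.
- move=> y x z; apply: d_le => g.
  by apply: le_trans (d0_tri (gact g y) _ _) _; rewrite lerD.
- move=> g x y; apply/eqP; rewrite eq_le inv_le /=.
  by have := inv_le (g^-1)%g (gact g x) (gact g y); rewrite !gactK.
- move=> x A; split.
    rewrite nbhsM => /nbhs_ballP [e /= e0 eA].
    exists (Num.min 1 e) => [|y]; first by rewrite lt_min ltr01.
    move=> /(le_lt_trans (le_d1 x y)); rewrite /d0 => lt; apply: eA.
    rewrite ballEmdist /=.
    by move: lt; rewrite lt_min !gt_min ltxx /= => /andP[h1 /orP[]//]; lra.
  move=> [e e0 eA]; apply: filterS eA _.
  have e4 : 0 < e / 4 by lra.
  (* Covering form of compactness: neighborhoods of [x] that work near each [g] yield one that works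
     for all of [G]. The estimate at [h] passes through [gact g x], whence [e / 4] twice. *)
  have : \forall y \near x, [set: G] `<=` (fun g => d0 (gact g x) (gact g y) < e / 2).
    move/compact_near_coveringP: cptG; apply=> g _.
    have [[P Q]/= [nP nQ] PQ] := gact_near (d0_near (gact g x) e4).
    exists (P, Q) => // -[h y] /= [Ph Qy].
    have h1 := PQ (h, y) (conj Ph Qy).
    have h2 := PQ (h, x) (conj Ph (nbhs_singleton nQ)); move: h1 h2 => /= h1 h2.
    have := d0_tri (gact g x) (gact h x) (gact h y).
    by rewrite {2}/d0 metric_sym -/(d0 _ _) => h3; lra.
  apply: filterS => y hy; apply: (@le_lt_trans _ _ (e / 2)); last by lra.
  by apply: d_le => g; apply: ltW; exact: hy.
Qed.

End invariant_metric.

Lemma metrizable_gmetric (R : realType) (G : topGroupType)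
    (X : gspaceType G) : compact [set: G] -> metrizable R X ->
  exists d : X -> X -> R, gmetric d.
Proof. by move=> cG [m mP]; have [d [? _]] := gmetric_of_metric cG mP; exists d. Qed.

Lemma completely_metrizable_gmetric (R : realType) (G : topGroupType)
    (X : gspaceType G) : compact [set: G] -> completely_metrizable R X ->
  exists d : X -> X -> R, gmetric d /\
    forall u : nat -> X,
      (forall e : R, 0 < e ->
        exists N, forall i j, (N <= i)%N -> (N <= j)%N -> d (u i) (u j) < e) ->
      exists x : X, u @ \oo --> x.
Proof.
move=> cG [m [mP cm]]; have [d [gd dm]] := gmetric_of_metric cG mP.
exists d; split=> // u cu; pose M := Metric.Pack m.
have [|x ux] := cm ((u : nat -> M) @ \oo) _.
  move=> A /=; rewrite -entourage_ballE => -[e /= e0 eA].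
  (* With a threshold at most [1] truncation is harmless: a truncated distance below it is the true
     distance. *)
  have [|N hN] := cu (Num.min 1 e); first by rewrite lt_min ltr01.
  exists (u @` [set n | (N <= n)%N], u @` [set n | (N <= n)%N]) => /=.
    by split; exists N => // n /= Nn; exists n.
  move=> [_ _] /= [[i Ni <-] [j Nj <-]]; apply: eA => /=.
  rewrite ballEmdist /=; have := le_lt_trans (dm (u i) (u j)) (hN _ _ Ni Nj).
  by rewrite lt_min !gt_min ltxx /= => /andP[h1 /orP[]//]; lra.
by exists x => A; rewrite mP => /ux.
Qed.

(** * G-spaces of bounded functions *)

(* Bounded functions on a G-set [J] on which precomposition with the action has
   continuous orbits for the supremum metric: these orbits being moved by
   isometries, the action is then jointly continuous. *)
Record function_gset (R : realType) (G : topGroupType) := FunctionGSet {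
  fg_dom : Type ;
  fg_pt : fg_dom ;
  fg_set : set (fg_dom -> R) ;
  fg_bound : forall u, fg_set u -> forall j, 0 <= u j <= 1 ;
  fg_act : G -> fg_dom -> fg_dom ;
  fg_act1 : forall j, fg_act 1%g j = j ;
  fg_actM : forall g h j, fg_act (g * h)%g j = fg_act g (fg_act h j) ;
  fg_inv : forall g u, fg_set u -> fg_set (fun j => u (fg_act (g^-1)%g j)) ;
  fg_orbit : forall u, fg_set u -> forall (g : G) (e : R), 0 < e ->
    \forall h \near g,
      forall j, `|u (fg_act (h^-1)%g j) - u (fg_act (g^-1)%g j)| <= e }.

Section function_gspace.
Context (R : realType) (G : topGroupType) (D : function_gset R G).

Definition fspace : Type := set_type (@fg_set R G D).
HB.instance Definition _ := Choice.on fspace.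

Definition fval (u : fspace) : fg_dom D -> R := set_val u.

Lemma fval_inj : injective fval.
Proof. exact: val_inj. Qed.

Lemma fvalP u : fg_set (fval u).
Proof. exact: (set_valP (u : set_type _)). Qed.

Definition Fval (u : fg_dom D -> R) (Du : fg_set u) : fspace :=
  exist _ u (mem_set Du).

Definition fdist (u v : fspace) : R :=
  sup [set `|fval u j - fval v j| | j in [set: fg_dom D]].

Lemma fdist_ub u v j : `|fval u j - fval v j| <= fdist u v.
Proof.
apply: ub_le_sup; last by exists j.
exists 1 => _ [k _ <-]; rewrite ler_norml.
have /andP[a b] := fg_bound (fvalP u) k; have /andP[c e] := fg_bound (fvalP v) k.
by apply/andP; split; lra.
Qed.

Lemma fdist_le u v c :
  (forall j, `|fval u j - fval v j| <= c) -> fdist u v <= c.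
Proof.
move=> h; apply: ge_sup => [|_ [j _ <-]//].
by exists `|fval u (fg_pt D) - fval v (fg_pt D)|, (fg_pt D).
Qed.

Fact fdistxx u : fdist u u = 0.
Proof.
apply/eqP; rewrite eq_le (le_trans _ (fdist_ub u u (fg_pt D)))// andbT.
by apply: fdist_le => j; rewrite subrr normr0.
Qed.

Fact fdist_eq u v : fdist u v = 0 -> u = v.
Proof.
move=> uv; apply: fval_inj; apply/funext => j.
by have := fdist_ub u v j; rewrite uv normr_le0 subr_eq0 => /eqP.
Qed.

Fact fdist_sym u v : fdist u v = fdist v u.
Proof.
suff le_sym a b : fdist a b <= fdist b a by apply/eqP; rewrite eq_le !le_sym.
by apply: fdist_le => j; rewrite distrC; exact: fdist_ub.
Qed.

Fact fdist_tri v u w : fdist u w <= fdist u v + fdist v w.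
Proof.
apply: fdist_le => j; apply: le_trans (ler_distD (fval v j) _ _) _.
by rewrite lerD ?fdist_ub.
Qed.

HB.instance Definition _ :=
  isMetric.Build R fspace fdistxx fdist_eq fdist_sym fdist_tri.

Lemma fnbhsP (u : fspace) (A : set fspace) :
  nbhs u A <-> exists2 e, 0 < e & forall v, fdist u v < e -> A v.
Proof.
split=> [/nbhs_ballP [e /= e0 eA]|[e e0 eA]].
  by exists e => // v uv; apply: eA; rewrite ballEmdist.
by apply/nbhs_ballP; exists e => // v; rewrite ballEmdist => /eA.
Qed.

Definition fact (g : G) (u : fspace) : fspace := Fval (fg_inv g (fvalP u)).

Lemma fval_act g u j : fval (fact g u) j = fval u (fg_act (g^-1)%g j).
Proof. by []. Qed.

Fact fact1 u : fact 1%g u = u.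
Proof. by apply: fval_inj; apply/funext => j; rewrite fval_act invg1 fg_act1. Qed.

Fact factM g h u : fact (g * h)%g u = fact g (fact h u).
Proof. by apply: fval_inj; apply/funext => j; rewrite !fval_act invgM fg_actM. Qed.

Lemma fact_isometry g u v : fdist (fact g u) (fact g v) = fdist u v.
Proof.
have le_act h a b : fdist (fact h a) (fact h b) <= fdist a b.
  by apply: fdist_le => j; rewrite !fval_act; exact: fdist_ub.
apply/eqP; rewrite eq_le le_act /=.
by have := le_act (g^-1)%g (fact g u) (fact g v); rewrite -!factM mulVg !fact1.
Qed.

Fact fact_continuous : continuous (fun p : G * fspace => fact p.1 p.2).
Proof.
move=> [g u] A /= /fnbhsP [e e0 eA].
have e3 : 0 < e / 3 by lra.
exists ([set h | forall j, `|fval u (fg_act (h^-1)%g j) -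
    fval u (fg_act (g^-1)%g j)| <= e / 3], [set v | fdist u v < e / 3]).
  split; first exact: (fg_orbit (fvalP u)).
  by apply/fnbhsP; exists (e / 3).
move=> [h v] /= [hh uv]; apply: eA.
have : fdist (fact g u) (fact h u) <= e / 3.
  by apply: fdist_le => j; rewrite distrC !fval_act; exact: hh.
have := fdist_tri (fact h u) (fact g u) (fact h v).
by rewrite fact_isometry; lra.
Qed.

HB.instance Definition _ := isGSpace.Build G fspace fact1 factM fact_continuous.

Lemma fspace_metrizable : metrizable R fspace.
Proof. by exists (Metric.class fspace). Qed.

End function_gspace.

(** * Distance to a set *)

Lemma inf_le_elem (R : realType) (S : set R) (c x : R) :
  lbound S c -> S x -> inf S <= x.
Proof. by move=> Sc; apply: ge_inf; exists c. Qed.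

Lemma inf_lt_elem (R : realType) (S : set R) (c x : R) :
  lbound S c -> S !=set0 -> inf S < x -> exists2 y, S y & y < x.
Proof.
move=> Sc S0 lt; apply: contrapT => no.
suff : x <= inf S by rewrite leNgt lt.
apply: lb_le_inf => // y Sy; rewrite leNgt; apply/negP => yx.
by apply: no; exists y.
Qed.

Section distance_to_set.
Context (R : realType) (G : topGroupType) (Z : gspaceType G) (d : Z -> Z -> R).
Context (gd : gmetric d).

Lemma gmetric_near (z : Z) (e : R) : 0 < e -> \forall w \near z, d z w < e.
Proof. by move=> e0; apply/(gm_nbhs gd); exists e. Qed.

(* The constant [1] makes the distance to the empty set equal to [1]. *)
Definition dset (B : set Z) (z : Z) : R :=
  inf ([set 1] `|` [set d z b | b in B]).

Let lb0 B z : lbound ([set 1] `|` [set d z b | b in B]) 0.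
Proof. by move=> _ [->|[b _ <-]]; [exact: ler01|exact: (gm_ge0 gd)]. Qed.

Lemma dset_ge0 B z : 0 <= dset B z.
Proof. by apply: lb_le_inf => //; exists 1; left. Qed.

Lemma dset_le1 B z : dset B z <= 1.
Proof. by apply: (inf_le_elem (@lb0 B z)); left. Qed.

Lemma dset_le (B : set Z) z b : B b -> dset B z <= d z b.
Proof. by move=> Bb; apply: (inf_le_elem (@lb0 B z)); right; exists b. Qed.

(** The bound [c <= 1] rules out the default value [1], so that the infimum is approached by points
    of [B]. *)
Lemma dset_lt (B : set Z) z (c : R) : c <= 1 -> dset B z < c ->
  exists2 b, B b & d z b < c.
Proof.
move=> c1 /(inf_lt_elem (@lb0 B z)) []; first by exists 1; left.
by move=> _ [->|[b Bb <-]] lt; [lra|exists b].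
Qed.

Lemma dset_lip B z w : dset B z <= d z w + dset B w.
Proof.
rewrite addrC -lerBlDr; apply: lb_le_inf; first by exists 1; left.
move=> _ [->|[b Bb <-]].
  by have := dset_le1 B z; have := gm_ge0 gd z w; lra.
by have := dset_le z Bb; have := gm_tri gd w z b; lra.
Qed.

Lemma dset_in (B : set Z) z : B z -> dset B z = 0.
Proof.
move=> Bz; apply/eqP; rewrite eq_le dset_ge0 andbT.
by rewrite -(gm_xx gd z); exact: dset_le.
Qed.

Lemma dset_closed (B : set Z) z : closed B -> dset B z = 0 -> B z.
Proof.
move=> cB z0; rewrite (closure_id B).1// => A /(gm_nbhs gd) [e e0 eA].
have [| |b Bb zb] := @dset_lt B z (Num.min 1 e); first by rewrite ge_min lexx.
  by rewrite z0 lt_min ltr01.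
exists b; split=> //; apply: eA; apply: lt_le_trans zb _.
by rewrite ge_min lexx orbT.
Qed.

Lemma dset_inv (B : set Z) (g : G) z :
  Defs.invariant B -> dset B (gact g z) = dset B z.
Proof.
move=> iB; congr inf; congr (_ `|` _); apply/seteqP; split=> _ [b Bb <-].
  exists (gact (g^-1)%g b); first exact: iB.
  by rewrite -(gm_inv gd g) gactVK.
by exists (gact g b); [exact: iB|rewrite (gm_inv gd)].
Qed.

Lemma dset_cts B : continuous (dset B).
Proof.
move=> z; apply/cvgrPdist_lt => e e0; apply: filterS (gmetric_near z e0) => w zw.
have := dset_lip B z w; have := dset_lip B w z; rewrite (gm_sym gd w).
by rewrite ltr_norml => h1 h2; apply/andP; split; lra.
Qed.

End distance_to_set.

(** * Gluing along a partial map *)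

(** Continuity of the restriction to [B], stated for a total [f] whose values off [B] are
    arbitrary. *)
Definition continuous_on (Z Y : topologicalType) (B : set Z) (f : Z -> Y) :=
  forall b, B b -> forall A, nbhs (f b) A -> \forall z \near b, B z -> A (f z).

Section adjunction.
Context (R : realType) (G : topGroupType) (Y Z : gspaceType G).
Context (dY : Y -> Y -> R) (gY : gmetric dY) (d : Z -> Z -> R) (gZ : gmetric d).
Context (B : set Z) (cB : closed B) (iB : Defs.invariant B).
Context (f : Z -> Y) (cf : continuous_on B f).
Context (ef : forall (g : G) b, B b -> f (gact g b) = gact g (f b)).

Let dl := dset d B.

(* As [z] approaches [b] in [B], the quotient [d z a / dl z] exceeds [2] unless
   [a] is close to [b]: the infimum then tends to [dY (f b) y]. *)
Let hval (z : Z) (y : Y) (a : Z) : R := dY (f a) y + (d z a / dl z - 1).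
Let hset (z : Z) (y : Y) := [set 1] `|` [set hval z y a | a in B].
Let h (z : Z) (y : Y) : R := inf (hset z y).

(** The Kuratowski embedding of [Y], with one more coordinate [None] that vanishes on it; on [Z]
    this coordinate is the distance to [B]. *)
Definition psiY (y : Y) (o : option Y) : R := oapp (dY y) 0 o.
Definition psiZ (z : Z) (o : option Y) : R :=
  if o is Some y then if `[< B z >] then dY (f z) y else h z y else dl z.

Let dl_gt0 z : ~ B z -> 0 < dl z.
Proof.
move=> nB; rewrite lt_neqAle dset_ge0// andbT; apply/eqP => /esym /(dset_closed gZ cB).
exact: nB.
Qed.

Let q_ge1 z a : ~ B z -> B a -> 1 <= d z a / dl z.
Proof. by move=> nB Ba; rewrite ler_pdivlMr ?dl_gt0// mul1r dset_le. Qed.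

Let hset_lb z y : ~ B z -> lbound (hset z y) 0.
Proof.
move=> nB _ [->|[a Ba <-]]; first exact: ler01.
by have := gm_ge0 gY (f a) y; have := q_ge1 nB Ba; rewrite /hval; lra.
Qed.

Let h_le1 z y : ~ B z -> h z y <= 1.
Proof. by move=> nB; apply: (inf_le_elem (hset_lb nB)); left. Qed.

Let h_ge0 z y : ~ B z -> 0 <= h z y.
Proof. by move=> nB; apply: lb_le_inf; [exists 1; left|exact: hset_lb]. Qed.

Let h_le z y a : ~ B z -> B a -> h z y <= hval z y a.
Proof. by move=> nB Ba; apply: (inf_le_elem (hset_lb nB)); right; exists a. Qed.

(** Points with quotient at least [2] give values at least [1], so only those with quotient below
    [2] can matter. *)
Let le_h z y (c : R) : c <= 1 ->
  (forall a, B a -> d z a / dl z < 2 -> c <= hval z y a) -> c <= h z y.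
Proof.
move=> c1 hc; apply: lb_le_inf; first by exists 1; left.
move=> _ [->//|[a Ba <-]].
have [lt2|ge2] := ltP (d z a / dl z) 2; first exact: hc.
by have := gm_ge0 gY (f a) y; rewrite /hval; lra.
Qed.

(** With [q] the quotient at [z], [d w a] is at most [d z w + q * dl z] and [dl z] at most
    [d z w + dl w]. As [q < 2], the term [d z w] occurs at most three times. *)
Let h_lip z w y : ~ B z -> ~ B w -> h w y <= h z y + 3 * d z w / dl w.
Proof.
move=> nBz nBw; have z0 := dl_gt0 nBz; have w0 := dl_gt0 nBw.
have zw0 := gm_ge0 gZ z w.
have e0 : 0 <= 3 * d z w / dl w by rewrite divr_ge0 ?mulr_ge0// ltW.
rewrite -lerBlDr; apply: le_h; first by have := h_le1 y nBw; lra.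
move=> a Ba q2; rewrite lerBlDr; apply: le_trans (h_le y nBw Ba) _.
suff : d w a / dl w <= d z a / dl z + 3 * d z w / dl w by rewrite /hval; lra.
rewrite ler_pdivrMr// mulrDl divfK ?gt_eqF//.
have := gm_tri gZ z w a; rewrite (gm_sym gZ w z).
have dza : d z a = d z a / dl z * dl z by rewrite divfK ?gt_eqF.
have := dset_lip gZ B z w; rewrite -/dl.
have := q_ge1 nBz Ba; move: (d z a / dl z) q2 dza => q *; nra.
Qed.

Lemma psiZ_in z : B z -> psiZ z = psiY (f z).
Proof.
move=> Bz; apply/funext => -[y|] /=; first by case: asboolP.
by rewrite /dl dset_in.
Qed.

Lemma psiY_bound y j : 0 <= psiY y j <= 1.
Proof. by case: j => [y'|] /=; rewrite ?gm_ge0 ?gm_le1 ?lexx ?ler01. Qed.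

Lemma psiZ_bound z j : 0 <= psiZ z j <= 1.
Proof.
case: (pselect (B z)) => [/psiZ_in ->|nB]; first exact: psiY_bound.
case: j => [y|] /=; last by rewrite dset_ge0 ?dset_le1.
by case: asboolP => // _; rewrite h_ge0 ?h_le1.
Qed.

Lemma psiY_dist y y' j : `|psiY y j - psiY y' j| <= dY y y'.
Proof.
case: j => [y''|] /=; last by rewrite subrr normr0 gm_ge0.
rewrite ler_norml; have := gm_tri gY y' y y''; have := gm_tri gY y y' y''.
by rewrite (gm_sym gY y' y) => *; apply/andP; split; lra.
Qed.

(** Off [B] this is the estimate [h_lip]. At a point of [B], all [a] that matter in the infimum at
    [w] are close to [z], so their images are close to [f z]. *)
Lemma psiZ_near z (e : R) : 0 < e ->
  \forall w \near z, forall j, `|psiZ w j - psiZ z j| <= e.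
Proof.
move=> e0; case: (pselect (B z)) => [Bz|nBz]; last first.
  have z0 := dl_gt0 nBz.
  (* The bound [dl z / 2] keeps [w] off [B] with [dl w] above [dl z / 2]; the bound [e * dl z / 6]
     then makes both Lipschitz terms at most [e]. *)
  pose r := Num.min e (Num.min (dl z / 2) (e * dl z / 6)).
  have r0 : 0 < r by rewrite !lt_min e0 !divr_gt0 ?mulr_gt0.
  apply: filterS (gmetric_near gZ z r0) => w.
  rewrite !lt_min => /and3P[zwe zw2 zw6].
  have zw0 := gm_ge0 gZ z w.
  have := dset_lip gZ B z w; have := dset_lip gZ B w z.
  rewrite (gm_sym gZ w) -/dl => l1 l2.
  have nBw : ~ B w by move=> /(dset_in gZ); rewrite -/dl => w0; lra.
  have w0 := dl_gt0 nBw.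
  move=> [y|] /=; last by rewrite ler_norml; apply/andP; split; lra.
  do 2 case: asboolP => // _.
  have := h_lip y nBz nBw; have := h_lip y nBw nBz; rewrite (gm_sym gZ w).
  have k1 : 3 * d z w / dl w <= e by rewrite ler_pdivrMr//; nra.
  have k2 : 3 * d z w / dl z <= e by rewrite ler_pdivrMr//; nra.
  by move=> *; rewrite ler_norml; apply/andP; split; lra.
have e2 : 0 < e / 2 by lra.
have [r r0 hr] : exists2 r : R, 0 < r &
    forall a, B a -> d z a < r -> dY (f z) (f a) < e / 2.
  have /(gm_nbhs gZ) [r r0 hr] := cf Bz (gmetric_near gY (f z) e2).
  by exists r => // a Ba /hr; apply.
(* If [a] is within [3 * dl w] of [w], then it is within [4 * d z w] of [z], because
   [dl w <= d z w]; hence [r / 4]. *)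
pose r' := Num.min (Num.min 1 e) (r / 4).
have r'0 : 0 < r' by rewrite !lt_min e0 ltr01 divr_gt0.
apply: filterS (gmetric_near gZ z r'0) => w.
rewrite !lt_min -andbA => /and3P[zw1 zwe zwr]; rewrite (psiZ_in Bz).
have zw0 := gm_ge0 gZ z w.
case: (pselect (B w)) => [Bw|nBw].
  move=> j; rewrite psiZ_in//; apply: le_trans (psiY_dist _ _ _) _.
  have lt : dY (f z) (f w) < e / 2 by apply: hr => //; lra.
  by rewrite (gm_sym gY); lra.
have w0 := dl_gt0 nBw.
have wz : dl w <= d z w by rewrite (gm_sym gZ); exact: dset_le.
move=> [y|] /=; last by rewrite subr0 ger0_norm; lra.
case: asboolP => // _.
have near_a a : B a -> d w a < 3 * dl w -> dY (f z) (f a) < e / 2.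
  by move=> Ba wa; apply: hr => //; have := gm_tri gZ w z a; lra.
have up : h w y <= dY (f z) y + e.
  (* A nearly closest point: the factor is at most [2], so that [near_a] applies, and exceeds [1] by
     at most [e / 2], which bounds the quotient term. The outer minimum with [1] serves
     [dset_lt]. *)
  have [a Ba wa] : exists2 a, B a & d w a < Num.min 1 ((1 + Num.min 1 (e / 2)) * dl w).
    apply: (dset_lt gZ); first by rewrite ge_min lexx.
    rewrite -/dl lt_min; apply/andP; split; first lra.
    by rewrite ltr_pMl// ltrDl lt_min ltr01.
  have m1 : Num.min 1 (e / 2) <= 1 by rewrite ge_min lexx.
  have m2 : Num.min 1 (e / 2) <= e / 2 by rewrite ge_min lexx orbT.
  have {}wa : d w a < (1 + Num.min 1 (e / 2)) * dl w.
    by move: wa; rewrite lt_min => /andP[].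
  apply: le_trans (h_le y nBw Ba) _; rewrite /hval.
  have := near_a _ Ba; have := gm_tri gY (f z) (f a) y; rewrite (gm_sym gY (f a) (f z)).
  have q : d w a / dl w <= 1 + e / 2 by rewrite ler_pdivrMr//; nra.
  by move=> t /(_ _); move: q t; have -> : d w a < 3 * dl w; [nra|move=> q t /(_ isT); lra].
have lo : dY (f z) y - e <= h w y.
  apply: le_h; first by have := gm_le1 gY (f z) y; lra.
  move=> a Ba q2; have q1 := q_ge1 nBw Ba.
  have wa : d w a < 3 * dl w by move: q2; rewrite ltr_pdivrMr//; nra.
  by have := near_a _ Ba wa; have := gm_tri gY (f a) (f z) y; rewrite /hval; lra.
by rewrite ler_norml; apply/andP; split; lra.
Qed.

Definition oact (g : G) (o : option Y) : option Y := omap (gact g) o.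

Lemma psiY_act g y j : psiY y (oact (g^-1)%g j) = psiY (gact g y) j.
Proof. by case: j => [y'|] //=; rewrite -(gm_inv gY g) gactVK. Qed.

(** Off [B], the substitution of [gact g a] for [a] in the infimum matches the two sets of
    values. *)
Lemma psiZ_act g z j : psiZ z (oact (g^-1)%g j) = psiZ (gact g z) j.
Proof.
case: (pselect (B z)) => [Bz|nBz].
  by rewrite psiZ_in// psiZ_in ?ef ?psiY_act//; exact: iB.
have nBg : ~ B (gact g z) by move=> /(iB (g^-1)%g); rewrite gactK.
case: j => [y|] /=; last by rewrite /dl dset_inv.
do 2 case: asboolP => // _; congr inf; congr (_ `|` _).
have valE a : B a -> hval z (gact (g^-1)%g y) a = hval (gact g z) y (gact g a).
  by move=> Ba; rewrite /hval ef// (gm_inv gZ) /dl dset_inv// -(gm_inv gY g) gactVK.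
apply/seteqP; split=> _ [a Ba <-].
  by rewrite valE//; exists (gact g a) => //; exact: iB.
exists (gact (g^-1)%g a); first exact: iB.
by rewrite valE ?gactVK//; exact: iB.
Qed.

(** The image of the adjunction space of [Y] and [Z] along [f]. The supremum metric replaces the
    quotient topology, which makes it metrizable. *)
Definition adj_set : set (option Y -> R) := range psiY `|` range psiZ.

Fact adj_bound u : adj_set u -> forall j, 0 <= u j <= 1.
Proof. by case=> -[? _ <-] j; [exact: psiY_bound|exact: psiZ_bound]. Qed.

Fact adj_act1 j : oact 1%g j = j.
Proof. by case: j => [y|] //=; rewrite gact1. Qed.

Fact adj_actM g k j : oact (g * k)%g j = oact g (oact k j).
Proof. by case: j => [y|] //=; rewrite gactM. Qed.

Fact adj_inv g u : adj_set u -> adj_set (fun j => u (oact (g^-1)%g j)).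
Proof.
case=> -[x _ <-]; [left; exists (gact g x)|right; exists (gact g x)] => //;
  by apply/funext => j; rewrite ?psiY_act ?psiZ_act.
Qed.

Fact adj_orbit u : adj_set u -> forall (g : G) (e : R), 0 < e ->
  \forall k \near g,
    forall j, `|u (oact (k^-1)%g j) - u (oact (g^-1)%g j)| <= e.
Proof.
case=> -[x _ <-] g e e0.
  apply: filterS (orbit_near (gmetric_near gY (gact g x) e0)) => k lt j.
  rewrite !psiY_act; apply: le_trans (psiY_dist _ _ _) _.
  by rewrite (gm_sym gY) ltW.
apply: filterS (orbit_near (psiZ_near (gact g x) e0)) => k lt j.
by rewrite !psiZ_act.
Qed.

Definition adj : function_gset R G :=
  FunctionGSet None adj_bound adj_act1 adj_actM adj_inv adj_orbit.

Definition injY (y : Y) : fspace adj :=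
  @Fval R G adj (psiY y) (or_introl (ex_intro2 _ _ y I erefl)).
Definition injZ (z : Z) : fspace adj :=
  @Fval R G adj (psiZ z) (or_intror (ex_intro2 _ _ z I erefl)).

Lemma injZ_in z : B z -> injZ z = injY (f z).
Proof. by move=> Bz; apply: fval_inj; exact: psiZ_in. Qed.

Lemma injY_gmap : gmap injY.
Proof.
split=> [y A /fnbhsP [e e0 eA]|g y].
  have := gmetric_near gY y (e0 : 0 < e); apply: filterS => y' yy'; apply: eA.
  by apply: le_lt_trans yy'; apply: fdist_le => j; exact: psiY_dist.
by apply: fval_inj; apply/funext => j; rewrite fval_act; exact/esym/psiY_act.
Qed.

Lemma injZ_gmap : gmap injZ.
Proof.
split=> [z A /fnbhsP [e e0 eA]|g z].
  have e2 : 0 < e / 2 by lra.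
  apply: filterS (psiZ_near z e2) => w zw; apply: eA.
  apply: (@le_lt_trans _ _ (e / 2)); last lra.
  by apply: fdist_le => j; rewrite distrC; exact: zw.
by apply: fval_inj; apply/funext => j; rewrite fval_act; exact/esym/psiZ_act.
Qed.

Lemma injY_isometry y y' : dY y y' <= fdist (injY y) (injY y').
Proof.
have : `|dY y y' - dY y' y'| <= _ := fdist_ub (injY y) (injY y') (Some y').
by rewrite (gm_xx gY) subr0 ger0_norm ?(gm_ge0 gY).
Qed.

(** The range is closed by the coordinate [None]: it vanishes on [Y] and equals [dl z > 0] at a
    point [z] off [B], so the ball of radius [dl z] misses [Y]. *)
Lemma injY_closed : closed_gembedding injY.
Proof.
have inj : injective injY.
  move=> y y' yy'; apply: (gm_eq gY); apply/eqP.
  by rewrite eq_le (gm_ge0 gY) andbT (le_trans (injY_isometry y y'))// yy' fdistxx.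
split; [exact: injY_gmap|exact: inj| |].
  apply/seteqP; split=> [U oU|_ [V oV <-]]; last first.
    by have [/continuousP cY _] := injY_gmap; exact: cY.
  (* The largest open set whose trace on the image of [Y] lies in that of [U]; by [injY_isometry] it
     contains the whole image of [U]. *)
  exists ([set u | forall y, u = injY y -> U y]°); first exact: open_interior.
  apply/seteqP; split=> [y /nbhs_singleton /(_ y erefl)//|y Uy].
  have /(gm_nbhs gY) [e e0 eU] := open_nbhs_nbhs (conj oU Uy).
  apply/fnbhsP; exists e => // v yv y' vy'; apply: eU.
  by apply: le_lt_trans yv; rewrite vy'; exact: injY_isometry.
rewrite -[range _]setCK; apply: open_closedC.
rewrite openE => u nu; have [[y _ yu]|[z _ zu]] := fvalP u.
  by exfalso; apply: nu; exists y => //; apply: fval_inj.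
have uE : u = injZ z by apply: fval_inj.
have nB : ~ B z by move=> /injZ_in Bz; apply: nu; exists (f z) => //; rewrite uE Bz.
apply/fnbhsP; exists (dl z); first exact: dl_gt0.
move=> v uv [y _ yv]; have : `|dl z - 0| <= _ := fdist_ub (injZ z) (injY y) None.
by rewrite subr0 ger0_norm ?dset_ge0// -uE yv leNgt uv.
Qed.

End adjunction.

(** * Extension of partial G-maps *)

Section subG_theory.
Context (G : topGroupType) (X : gspaceType G) (S : set X) (iS : Defs.invariant S).

Definition toSub (x : X) (Sx : S x) : subG iS := exist _ x (mem_set Sx).

Lemma subG_valP (u : subG iS) : S (subG_val u).
Proof. exact: (set_valP (u : set_type S)). Qed.

Lemma subG_nbhs (u : subG iS) (A : set (subG iS)) :
  nbhs u A <-> exists2 C, nbhs (subG_val u) C & forall v, C (subG_val v) -> A v.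
Proof.
split=> [[_ [[C oC <-] Cu CA]]|[C nC CA]].
  by exists C => //; exact: open_nbhs_nbhs.
have nu : nbhs u (@subG_val G X S iS @^-1` C) := subG_val_continuous nC.
by apply: filterS nu => v; exact: CA.
Qed.

Lemma subG_cts (T : topologicalType) (phi : T -> subG iS) :
  continuous (fun t => subG_val (phi t)) -> continuous phi.
Proof.
move=> c t A /subG_nbhs [C nC CA].
have nt : nbhs t ((fun t => subG_val (phi t)) @^-1` C) := c t _ nC.
by apply: filterS nt => s; exact: CA.
Qed.

Lemma subG_gmetric (R : realType) (d : X -> X -> R) : gmetric d ->
  gmetric (fun u v : subG iS => d (subG_val u) (subG_val v)).
Proof.
move=> gd; split.
- by move=> *; exact: (gm_ge0 gd).
- by move=> *; exact: (gm_le1 gd).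
- by move=> *; exact: (gm_xx gd).
- by move=> u v /(gm_eq gd) /subG_val_inj.
- by move=> *; exact: (gm_sym gd).
- by move=> *; exact: (gm_tri gd).
- by move=> *; exact: (gm_inv gd).
move=> x A; rewrite subG_nbhs; split=> [[C /(gm_nbhs gd) [e e0 eC] CA]|[e e0 eA]].
  by exists e => // v /eC; exact: CA.
exists [set y | d (subG_val x) y < e] => //.
by apply/(gm_nbhs gd); exists e.
Qed.

Lemma interior_invariant : Defs.invariant S°.
Proof.
move=> g x Sx; have nS : nbhs (gact (g^-1)%g (gact g x)) S by rewrite gactK.
have {}nS : nbhs (gact g x) (gact (g^-1)%g @^-1` S) := gact_cts nS.
by apply: filterS nS => y /(iS g); rewrite gactVK.
Qed.

End subG_theory.
Arguments toSub {G X S} iS {x} Sx.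

Section extension.
Context (R : realType) (G : topGroupType) (Y Z : gspaceType G).
Context (dY : Y -> Y -> R) (gY : gmetric dY) (d : Z -> Z -> R) (gZ : gmetric d).
Context (B : set Z) (cB : closed B) (iB : Defs.invariant B).
Context (f : Z -> Y) (cf : continuous_on B f).
Context (ef : forall (g : G) b, B b -> f (gact g b) = gact g (f b)).

(** A retraction of a neighborhood of [Y] in the glued space, composed with [injZ], extends [f],
    since [injZ] agrees with [injY] after [f] on [B]. *)
Lemma G_ANR_extension : G_ANR R Y ->
  exists (N : set Z) (iN : Defs.invariant N) (r : subG iN -> Y),
    [/\ open N, B `<=` N, gmap r &
        forall u, B (subG_val u) -> r u = f (subG_val u)].
Proof.
case=> _ /(_ (fspace (adj gY gZ cB iB cf ef)) (injY gY gZ cB iB cf ef)).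
case; [exact: fspace_metrizable|exact: injY_closed|move=> U [iU [r [subU gr rE]]]].
pose F := injZ gY gZ cB iB cf ef.
have [Fc Fe] : gmap F by exact: injZ_gmap.
pose N := F @^-1` U°.
have iN : Defs.invariant N.
  by move=> g z Nz; rewrite /N /= Fe; exact: interior_invariant.
have NU (u : subG iN) : U (F (subG_val u)).
  exact: interior_subset (subG_valP u).
pose lift u := toSub iU (NU u).
exists N, iN, (r \o lift); split.
- by move/continuousP: Fc; apply; exact: open_interior.
- by move=> b Bb; rewrite /N /= /F injZ_in//; apply: subU; exists (f b).
- split=> [u|g u].
    apply: continuous_comp; last exact: gr.1.
    apply: subG_cts => v; apply: (continuous_comp (f := @subG_val G Z N iN)).
      exact: subG_val_continuous.
    exact: Fc.
  rewrite /= -gr.2; congr r; apply: subG_val_inj; exact: Fe.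
- by move=> u Bu /=; apply: rE; rewrite /lift /=; exact: injZ_in.
Qed.

Lemma G_AR_extension : G_AR R Y ->
  exists r : Z -> Y, gmap r /\ forall b, B b -> r b = f b.
Proof.
case=> _ /(_ (fspace (adj gY gZ cB iB cf ef)) (injY gY gZ cB iB cf ef)).
case; [exact: fspace_metrizable|exact: injY_closed|move=> r [[rc re] rE]].
pose F := injZ gY gZ cB iB cf ef.
have [Fc Fe] : gmap F by exact: injZ_gmap.
exists (r \o F); split; last by move=> b Bb; rewrite /= /F injZ_in.
split=> [z|g z]; first by apply: continuous_comp; [exact: Fc|exact: rc].
by rewrite /= Fe re.
Qed.

End extension.

(** * Controlled homotopy extension *)

Section unit_interval.
Context (R : realType).
Local Notation I := (set_type (@unit_itv R)).

Lemma unit_itvP (t : I) : 0 <= set_val t <= 1.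
Proof. by have := set_valP t; rewrite /unit_itv /= in_itv. Qed.

Lemma unit_nbhs (t : I) (A : set I) :
  nbhs t A <-> exists2 e : R, 0 < e &
    forall u : I, `|set_val t - set_val u| < e -> A u.
Proof.
split=> [[_ [[C oC <-] Ct CA]]|[e e0 eA]].
  have /nbhs_ballP [e /= e0 eC] := open_nbhs_nbhs (conj oC Ct).
  by exists e => // u tu; apply: CA; exact: eC.
have nt : nbhs t (set_val @^-1` ball (set_val t : R) e).
  by apply: initial_continuous; exact: nbhsx_ballx.
by apply: filterS nt => u; exact: eA.
Qed.

Lemma unit_cts (T : topologicalType) (phi : T -> I) :
  continuous (fun x => set_val (phi x) : R) -> continuous phi.
Proof.
move=> c x A /unit_nbhs [e e0 eA].
have nx : nbhs x ((fun x => set_val (phi x) : R) @^-1` ball (set_val (phi x)) e).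
  by apply: c; exact: nbhsx_ballx.
by apply: filterS nx => y; exact: eA.
Qed.

End unit_interval.

(** An alias of the product, to which the action trivial on the interval is attached. *)
Definition cyl (R : realType) (G : topGroupType) (X : gspaceType G) : Type :=
  (X * set_type (@unit_itv R))%type.

Section cylinder.
Context (R : realType) (G : topGroupType) (X : gspaceType G).
Local Notation I := (set_type (@unit_itv R)).

HB.instance Definition _ := Topological.copy (cyl R X) (X * I)%type.

Definition cyl_act (g : G) (p : cyl R X) : cyl R X := (gact g p.1, p.2).

Fact cyl_act1 p : cyl_act 1%g p = p.
Proof. by case: p => x t; rewrite /cyl_act gact1. Qed.

Fact cyl_actM g h p : cyl_act (g * h)%g p = cyl_act g (cyl_act h p).
Proof. by rewrite /cyl_act gactM. Qed.

Fact cyl_act_continuous : continuous (fun q : G * cyl R X => cyl_act q.1 q.2).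
Proof.
move=> [g [x t]] A /= [[P Q] /= [nP nQ] PQ].
have [[P1 P2] /= [n1 n2] P12] := gact_near nP.
exists (P1, P2 `*` Q) => /=; first by split=> //; exists (P2, Q).
by move=> [h [y u]] /= [hP [yP uQ]]; apply: PQ; split=> //=; exact: (P12 (h, y)).
Qed.

HB.instance Definition _ :=
  isGSpace.Build G (cyl R X) cyl_act1 cyl_actM cyl_act_continuous.

Lemma cyl_gmetric (d : X -> X -> R) : gmetric d ->
  gmetric (fun p q : cyl R X => Num.max (d p.1 q.1) `|set_val p.2 - set_val q.2|).
Proof.
move=> gd; split.
- by move=> p q; rewrite le_max (gm_ge0 gd).
- move=> p q; rewrite ge_max (gm_le1 gd) /= ler_norml.
  have /andP[? ?] := unit_itvP p.2; have /andP[? ?] := unit_itvP q.2.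
  by apply/andP; split; lra.
- by move=> p; rewrite (gm_xx gd) subrr normr0 maxxx.
- move=> [x t] [y u] /= m0.
  have : Num.max (d x y) `|set_val t - set_val u| <= 0 by rewrite m0.
  rewrite ge_max normr_le0 subr_eq0 => /andP[d0 /eqP /val_inj ->].
  by rewrite (gm_eq gd (x := x) (y := y))//; apply/eqP; rewrite eq_le d0 (gm_ge0 gd).
- by move=> p q; rewrite (gm_sym gd) distrC.
- move=> q p r; rewrite ge_max; apply/andP; split.
    by apply: le_trans (gm_tri gd q.1 _ _) _; rewrite lerD// le_max lexx.
  apply: le_trans (ler_distD (set_val q.2) _ _) _.
  by rewrite lerD// le_max lexx orbT.
- by move=> g p q; rewrite (gm_inv gd).
move=> [x t] A; split=> [[[P Q] /= [/(gm_nbhs gd) [e e0 eP] /unit_nbhs [r r0 rQ]] PQ]|].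
  exists (Num.min e r) => [|[y u] /=]; first by rewrite lt_min e0.
  rewrite gt_max !lt_min => /andP[/andP[ye _] /andP[_ ur]].
  by apply: PQ; split; [exact: eP|exact: rQ].
move=> [e e0 eA]; exists ([set y | d x y < e], [set u | `|set_val t - set_val u| < e]).
  by split; [apply/(gm_nbhs gd)|apply/unit_nbhs]; exists e.
by move=> [y u] /= [ye ue]; apply: eA; rewrite gt_max ye.
Qed.

End cylinder.

Section homotopy_extension.
Context (R : realType) (G : topGroupType) (A Y Z : gspaceType G).
Local Notation I := (set_type (@unit_itv R)).
Context (dY : Y -> Y -> R) (gY : gmetric dY) (d : Z -> Z -> R) (gZ : gmetric d).
Context (anrY : G_ANR R Y).
Context (e : A -> Z) (emb_e : closed_gembedding e).
Context (s : Z -> Y) (gs : gmap s).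
Context (h : A * I -> Y) (hh : ghomotopy h).
Context (h0 : forall a, h (a, unit_itv0 R) = s (e a)).
Context (W : set (set Y)) (openW : forall V, W V -> open V).
Context (coverW : forall y, exists2 V, W V & V y).
Context (invW : forall (g : G) V, W V ->
  exists2 V', W V' & forall y, V y -> V' (gact g y)).
Context (trackW : forall a, exists2 V, W V & forall t, V (h (a, t))).

Let gC := cyl_gmetric gZ.
Let C : set (cyl R Z) := [set p | p.2 = unit_itv0 R \/ range e p.1].

Let f (p : cyl R Z) : Y :=
  match pselect (exists a, e a = p.1) with
  | left ea => h (projT1 (cid ea), p.2)
  | right _ => s p.1
  end.

Let f_e a t : f (e a, t) = h (a, t).
Proof.
rewrite /f /=; case: pselect => [ea|]; last by case; exists a.
by case: cid => b /= be; congr (h (_, _)); case: emb_e => _ inj _ _; exact: inj.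
Qed.

Let f_0 z : f (z, unit_itv0 R) = s z.
Proof.
case: (pselect (range e z)) => [[a _ <-]|nz]; first by rewrite f_e h0.
by rewrite /f /=; case: pselect => // -[a az]; case: nz; exists a.
Qed.

Let range_inv : Defs.invariant (range e).
Proof.
move=> g _ [a _ <-]; exists (gact g a) => //.
by case: emb_e => -[_ ->].
Qed.

Let closed_e : closed (range e). Proof. by case: emb_e. Qed.

Let closedC : closed C.
Proof.
have -> : C = ((fun p : cyl R Z => set_val p.2 : R) @^-1` [set 0]) `|`
    ((fun p : cyl R Z => p.1) @^-1` range e).
  apply/seteqP; split=> -[z t] /= [t0|]; [left|by right|left|by right].
    by move: t0 => /= ->.
  exact: val_inj.
apply: closedU.
  apply: (@preimage_closed _ _ _ _ _); last exact: closed_eq.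
  move=> p _; apply: (@continuous_comp _ _ _ (fun p : cyl R Z => p.2) set_val).
    exact: cvg_snd.
  exact: initial_continuous.
apply: preimage_closed => // p _; exact: cvg_fst.
Qed.

Let invC : Defs.invariant C.
Proof.
move=> g [z t] [/= t0|/= ez]; first by left.
by right; exact: range_inv.
Qed.

(** Off the closed set [range e], nearby points of [C] have time [0]; at positive time they lie over
    [range e]; over [range e] at time [0] the two definitions agree and both are continuous. *)
Let cts_f : continuous_on C f.
Proof.
move=> [z t] Cz V; case: (pselect (range e z)) => [[a _ az]|nz]; last first.
  case: Cz => /= [->|//]; rewrite f_0 => nV.
  have nzV : nbhs z (s @^-1` V `&` ~` range e).
    apply: filterI; first exact: gs.1.
    by apply: open_nbhs_nbhs; split=> //; exact: closed_openC.
  exists (s @^-1` V `&` ~` range e, setT).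
    by split=> //; exact: filterT.
  move=> [w u] /= [[sw nw] _] [/= ->|//]; first by rewrite f_0.
rewrite -az f_e az => nV.
have [[P Q] /= [nP nQ] PQ] := hh.1 (a, t) V nV.
(* Since [e] is a topological embedding, a neighborhood in [A] contains the trace of one in [Z]. *)
have [E nO OP] : exists2 E, nbhs z E & forall b, E (e b) -> P b.
  case: emb_e => _ _ topA _.
  move: nP; rewrite nbhsE => -[P' [+ P'a] P'P]; rewrite topA => -[E oO OP'].
  exists E; last by move=> b Ob; apply: P'P; rewrite -OP'.
  by apply: open_nbhs_nbhs; split=> //; rewrite -az; move: P'a; rewrite -OP'.
have [t0|tn0] := pselect (t = unit_itv0 R).
  have nzV : nbhs z (s @^-1` V).
    by apply: gs.1; rewrite -az -h0 -t0.
  exists (E `&` s @^-1` V, Q) => /=.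
    by split=> //; exact: filterI.
  move=> [w u] /= [[Ow sw] Qu] [/= ->|[b _ /= bw]]; first by rewrite f_0.
  by rewrite -bw f_e; apply: (PQ (b, u)); split=> //; apply: OP; rewrite bw.
have nQ0 : nbhs t (Q `&` [set u | u <> unit_itv0 R]).
  apply: filterI => //; apply/unit_nbhs; exists `|set_val t - 0|.
    rewrite normr_gt0 subr_eq0; apply/eqP => t0; apply: tn0; exact: val_inj.
  by move=> u + u0; rewrite u0 ltxx.
exists (E, Q `&` [set u | u <> unit_itv0 R]) => //.
move=> [w u] /= [Ow [Qu un0]] [//|[b _ /= bw]].
by rewrite -bw f_e; apply: (PQ (b, u)); split=> //; apply: OP; rewrite bw.
Qed.

Let equiv_f (g : G) p : C p -> f (gact g p) = gact g (f p).
Proof.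
case: p => z t; case: (pselect (range e z)) => [[a _ <-] _|nz].
  have -> : gact g ((e a, t) : cyl R Z) = (e (gact g a), t).
    by case: emb_e => -[_ ->].
  by rewrite !f_e hh.2.
by move=> [/= ->|//]; rewrite [LHS]f_0 f_0 gs.2.
Qed.

(** Extend [f] to a neighborhood [N] of the bottom and of the cylinder over [range e], then evaluate
    along the graph of an invariant Urysohn function [lam]. The result is defined on all of [Z]
    because [lam] is [0] where the segments may leave [N]. *)
Lemma homotopy_extension : exists s' : Z -> Y, [/\ gmap s',
  forall a, s' (e a) = h (a, unit_itv1 R) &
  forall z, exists V, [/\ W V, V (s z) & V (s' z)]].
Proof.
have [N [iN [r [oN CN gr rE]]]] :=
  G_ANR_extension gY gC closedC invC cts_f equiv_f anrY.
(* The points whose whole vertical segment stays in [N] and is mapped into a single member of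
   [W]. *)
pose V : set Z := [set z | exists2 U, W U &
  forall t : I, exists q : N (z, t), U (r (toSub iN q))].
have eV : range e `<=` V.
  move=> _ [a _ <-]; have [U WU hU] := trackW a; exists U => // t.
  have Ca : C (e a, t) by right; exists a.
  by exists (CN _ Ca); rewrite rE// f_e.
have iV : Defs.invariant V.
  move=> g z [U WU rU]; have [U' WU' UU'] := invW g WU; exists U' => // t.
  have [q Uq] := rU t; exists (iN g _ q).
  rewrite (_ : toSub _ _ = gact g (toSub iN q)); last exact: subG_val_inj.
  by rewrite gr.2; exact: UU'.
have oV : open V.
  rewrite openE => z [U WU rU].
  (* Tube argument: compactness of the interval gives a neighborhood of [z] that is good for all
     times at once. *)
  suff : \forall w \near z, @unit_itv R `<=` (fun x => forall t : I, set_val t = x ->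
      exists q : N (w, t), U (r (toSub iN q))).
    apply: filterS => w hw; exists U => // t; apply: (hw (set_val t)) => //.
    exact: set_valP.
  have /compact_near_coveringP : compact (@unit_itv R) by exact: segment_compact.
  apply=> x Ix; pose t : I := exist _ x (mem_set Ix).
  have [q Uq] := rU t.
  have : nbhs (toSub iN q) (r @^-1` U).
    by apply: gr.1; apply: open_nbhs_nbhs; split=> //; exact: openW.
  move=> /subG_nbhs [D nD DU].
  have [[P Q] /= [nP /unit_nbhs [c c0 cQ]] PQ] : nbhs ((z, t) : cyl R Z) (D `&` N).
    by apply: filterI => //; exact: open_nbhs_nbhs.
  exists (ball x c, P); first by split=> //; exact: nbhsx_ballx.
  move=> [y w] /= [xy Pw] u uy.
  have [Dw Nw] : (D `&` N) (w, u) by apply: PQ; split=> //=; apply: cQ; rewrite uy.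
  by exists Nw; exact: DU.
(* The function [lam] is [dV / (dE + dV)], equal to [1] on [range e] and to [0] off [V]. An empty
   [range e] or complement of [V] is covered by the default distance [1]. *)
pose dE := dset d (range e); pose dV := dset d (~` V).
have dE0 z : 0 <= dE z := dset_ge0 gZ _ z.
have dV0 z : 0 <= dV z := dset_ge0 gZ _ z.
have pos z : 0 < dE z + dV z.
  have [E0|En0] := eqVneq (dE z) 0; last first.
    by rewrite ltr_wpDr// lt_neqAle eq_sym En0 dE0.
  have [V0|Vn0] := eqVneq (dV z) 0; last first.
    by rewrite ltr_wpDl// lt_neqAle eq_sym Vn0 dV0.
  have /(dset_closed gZ) /(_ V0) := open_closedC oV.
  by case; apply: eV; exact: (dset_closed gZ closed_e).
have lam01 z : @unit_itv R (dV z / (dE z + dV z)).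
  rewrite /unit_itv /= in_itv /= divr_ge0//= ?(ltW (pos z))//.
  by rewrite ler_pdivrMr// mul1r lerDr.
pose lam z : I := exist _ (dV z / (dE z + dV z)) (mem_set (lam01 z)).
have lam_cts : continuous lam.
  apply: unit_cts => z; apply: cvgM; first exact: (dset_cts gZ).
  apply: cvgV; first by rewrite gt_eqF.
  by apply: cvgD; exact: (dset_cts gZ).
have iVc : Defs.invariant (~` V).
  by move=> g z nV /(iV (g^-1)%g); rewrite gactK.
have lam_inv (g : G) z : lam (gact g z) = lam z.
  by apply: val_inj; rewrite /= /dE /dV !dset_inv.
have lam0 z : ~ V z -> lam z = unit_itv0 R.
  by move=> nV; apply: val_inj; rewrite /= /dV dset_in// mul0r.
have lam1 a : lam (e a) = unit_itv1 R.
  have E0 : dE (e a) = 0 by apply: (dset_in gZ); exists a.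
  apply: val_inj => /=; have := pos (e a); rewrite E0 add0r => ?.
  by rewrite divff ?gt_eqF.
have HN z : N (z, lam z).
  case: (pselect (V z)) => [[U _ rU]|/lam0 ->]; first by have [q] := rU (lam z).
  by apply: CN; left.
pose s' z := r (toSub iN (HN z)).
have s'E z : C (z, lam z) -> s' z = f (z, lam z) by move=> Cz; exact: rE.
have rN z t (p q : N (z, t)) : r (toSub iN p) = r (toSub iN q).
  by congr r; exact: subG_val_inj.
have r0 z (q : N (z, unit_itv0 R)) : r (toSub iN q) = s z.
  by rewrite rE ?f_0//; left.
exists s'; split.
- split=> [z|g z].
    apply: (@continuous_comp _ _ _ (fun z => toSub iN (HN z)) r); last exact: gr.1.
    apply: subG_cts => w A' [[P Q] /= [nP nQ] PQ].
    have nL : nbhs w (lam @^-1` Q) := lam_cts _ _ nQ.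
    by apply: filterS (filterI nP nL) => v [Pv Qv]; apply: (PQ (v, lam v)).
  rewrite /s' -gr.2; congr r; apply: subG_val_inj.
  by change ((gact g z, lam (gact g z)) = (gact g z, lam z)); rewrite lam_inv.
- by move=> a; rewrite s'E ?lam1 ?f_e//; right; exists a.
- move=> z; case: (pselect (V z)) => [[U WU rU]|nV].
    exists U; split=> //.
      by have [q] := rU (unit_itv0 R); rewrite r0.
    by have [q] := rU (lam z); rewrite /s' (rN _ _ _ q).
  have [U WU Us] := coverW (s z); exists U; split=> //.
  suff -> : s' z = s z by [].
  by rewrite s'E lam0 ?f_0//; left.
Qed.

End homotopy_extension.

(** * Inverse limits *)

(** The proof that [d] is a [gmetric] is a phantom argument, so that the metric structure lives on
    an alias and [X] keeps its own topology. *)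
Definition metrized (R : realType) (G : topGroupType) (X : gspaceType G)
  (d : X -> X -> R) of gmetric d : Type := X.

Section metrized.
Context (R : realType) (G : topGroupType) (X : gspaceType G).
Context (d : X -> X -> R) (gd : gmetric d).

HB.instance Definition _ := Choice.copy (metrized gd) X.
HB.instance Definition _ := isMetric.Build R (metrized gd)
  (gm_xx gd) (gm_eq gd) (gm_sym gd) (gm_tri gd).

Lemma gmetric_metrizable : metrizable R X.
Proof.
exists (Metric.class (metrized gd)) => /= x; apply/seteqP; split=> A.
  move=> /(gm_nbhs gd) [e e0 eA].
  apply/(@nbhs_ballP R (metrized gd)); by exists e.
move=> /(@nbhs_ballP R (metrized gd)) [e e0 eA].
by apply/(gm_nbhs gd); exists e.
Qed.

End metrized.

Lemma half_lt (R : realType) (e : R) : 0 < e -> exists n : nat, 2^-1 ^+ n < e.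
Proof.
move=> e0; have [n _ hn] := near_infty_natSinv_expn_lt (PosNum e0).
by exists n; have := hn n (leqnn n); rewrite /= div1r exprVn.
Qed.

Lemma half_anti (R : realType) (m n : nat) :
  (m <= n)%N -> 2^-1 ^+ n <= 2^-1 ^+ m :> R.
Proof. by move=> mn; rewrite ler_wiXn2l//; lra. Qed.

Lemma half_gt0 (R : realType) (n : nat) : 0 < 2^-1 ^+ n :> R.
Proof. by rewrite exprn_gt0//; lra. Qed.

Lemma near_forall_ltn (T : Type) (F : set_system T) (P : nat -> T -> Prop) :
  Filter F -> (forall k, \forall x \near F, P k x) ->
  forall m, \forall x \near F, forall k, (k < m)%N -> P k x.
Proof.
move=> FF hP; elim=> [|m IH]; first by apply: nearW.
apply: filterS (filterI IH (hP m)) => x [h1 h2] k.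
by rewrite ltnS leq_eqVlt => /predU1P[->|/h1].
Qed.

(** * Countable products *)

Section countable_product.
Context (R : realType) (G : topGroupType) (X : nat -> gspaceType G).
Context (d : forall i, X i -> X i -> R) (gd : forall i, gmetric (@d i)).
Local Notation P := (prod_topology X).

Lemma prod_cts (T : topologicalType) (phi : T -> P) :
  (forall i, continuous (fun t => phi t i : X i)) -> continuous phi.
Proof.
move=> c t; apply/cvg_sup => i A [B [[C oC <-] Ct CA]].
have nt : nbhs t ((fun t => phi t i : X i) @^-1` C).
  by apply: c; exact: open_nbhs_nbhs.
by apply: (filterS _ nt) => s; exact: CA.
Qed.

Let term (x y : P) i : R := Num.min (2^-1 ^+ i) (d (x i) (y i)).

Let term_ge0 x y i : 0 <= term x y i.
Proof. by rewrite le_min (gm_ge0 (gd i)) ltW ?half_gt0. Qed.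

Let term_le1 x y i : term x y i <= 1.
Proof. by rewrite ge_min (gm_le1 (gd i)) orbT. Qed.

Definition pdist (x y : P) : R := sup (range (term x y)).

Let pdist_ub x y i : term x y i <= pdist x y.
Proof. by apply: ub_le_sup; [exists 1 => _ [j _ <-]|exists i]. Qed.

Let pdist_le x y c : (forall i, term x y i <= c) -> pdist x y <= c.
Proof.
by move=> h; apply: ge_sup => [|_ [j _ <-]//]; exists (term x y 0%N), 0%N.
Qed.

(** Cutting coordinate [i] off at [2^-1 ^+ i] leaves finitely many coordinates to control for a
    given precision, as in the product topology. *)
Lemma prod_gmetric : gmetric pdist.
Proof.
have sym x y : pdist x y = pdist y x.
  rewrite /pdist; suff -> : term x y = term y x by [].
  by apply/funext => i; rewrite /term (gm_sym (gd i)).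
split=> //.
- by move=> x y; apply: le_trans (pdist_ub x y 0%N).
- by move=> x y; exact: pdist_le.
- move=> x; apply/eqP; rewrite eq_le (le_trans _ (pdist_ub x x 0%N))// andbT.
  by apply: pdist_le => i; rewrite /term (gm_xx (gd i)) ge_min lexx orbT.
- move=> x y xy; apply: functional_extensionality_dep => i.
  apply: (gm_eq (gd i)); have := pdist_ub x y i; rewrite xy /term ge_min.
  rewrite leNgt half_gt0 /= => le0; apply/eqP.
  by rewrite eq_le le0 (gm_ge0 (gd i)).
- move=> y x z; apply: pdist_le => i.
  apply: le_trans (lerD (pdist_ub x y i) (pdist_ub y z i)).
  have := gm_tri (gd i) (y i) (x i) (z i); have := half_gt0 R i.
  have := gm_ge0 (gd i) (x i) (y i); have := gm_ge0 (gd i) (y i) (z i).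
  by rewrite /term !minEle; do 3 case: ifP; move=> *; lra.
- move=> g x y; rewrite /pdist; suff -> : term (gact g x) (gact g y) = term x y by [].
  by apply/funext => i; rewrite /term (gm_inv (gd i)).
move=> x A; split.
  (* The filter of the balls around [x]; its convergence to [x] in the product topology can be
     tested on coordinates. *)
  pose F : set_system P := [set A | exists2 e : R, 0 < e & forall y, pdist x y < e -> A y].
  have FF : Filter F.
    split; first by exists 1.
      move=> A1 A2 [e1 e10 h1] [e2 e20 h2]; exists (Num.min e1 e2).
        by rewrite lt_min e10.
      by move=> y; rewrite lt_min => /andP[/h1 ? /h2 ?].
    by move=> A1 A2 A12 [e1 e10 h1]; exists e1 => // y /h1 /A12.
  suff : F --> x by apply.
  apply/cvg_sup => i A' [B [[C oC <-] Cx CA]].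
  have /(gm_nbhs (gd i)) [e e0 eC] := open_nbhs_nbhs (conj oC Cx).
  exists (Num.min e (2^-1 ^+ i)); first by rewrite lt_min e0 half_gt0.
  move=> y /(le_lt_trans (pdist_ub x y i)) lt; apply: CA; apply: eC.
  by move: lt; rewrite /term lt_min !gt_min ltxx /= => /andP[/orP[] *]; lra.
move=> [e e0 eA]; have e2 : 0 < e / 2 by lra.
(* From coordinate [N] on the terms are below [e / 2] whatever [y] is. *)
have [N hN] := half_lt e2.
have : \forall y \near x, forall i, (i < N)%N -> d (x i) (y i) < e / 2.
  apply: (@near_forall_ltn P (nbhs x) (fun i y => d (x i) (y i) < e / 2)) => i.
  have ni : nbhs (x i) [set z | d (x i) z < e / 2].
    by apply/(gm_nbhs (gd i)); exists (e / 2).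
  exact: (@proj_continuous nat (fun i => X i : topologicalType) i x _ ni).
apply: filterS => y hy; apply: eA; apply: (@le_lt_trans _ _ (e / 2)); last lra.
apply: pdist_le => i; rewrite /term ge_min; have [iN|Ni] := ltnP i N.
  by rewrite (ltW (hy _ iN)) orbT.
by rewrite (le_trans (half_anti R Ni))// ltW.
Qed.

End countable_product.

Lemma invlim_coord_gmap (G : topGroupType) (X : inverse_sequence G) i :
  gmap (fun x : invlim X => subG_val x i : X i).
Proof.
split=> // x A nA.
have nP : nbhs (subG_val x) (fun y : prod_topology (fun i => X i) => A (y i)).
  exact: (@proj_continuous nat (fun i => X i : topologicalType) i (subG_val x) _ nA).
exact: (subG_val_continuous nP).
Qed.

(** * Retractions onto the inverse limit *)

Section limit.
Context (R : realType) (G : topGroupType) (cptG : compact [set: G]).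
Context (X : inverse_sequence G).
Context (cmX : forall i : nat, completely_metrizable R (X i)).
Context (anrX : forall i : nat, G_ANR R (X i)).
Context (fineX : forall i : nat, fine_ghomotopy_equivalence R (bond X (leqnSn i))).

Let d i := projT1 (cid (completely_metrizable_gmetric cptG (cmX i))).

Let gd i : gmetric (@d i).
Proof. by rewrite /d; case: cid => ? []. Qed.

Let complete_d i (u : nat -> X i) :
  (forall e : R, 0 < e ->
    exists N, forall a b, (N <= a)%N -> (N <= b)%N -> d (u a) (u b) < e) ->
  exists x : X i, u @ \oo --> x.
Proof. by rewrite /d; case: cid => /= ? [_ h]; exact: h. Qed.

Lemma invlim_metrizable : metrizable R (invlim X).
Proof. exact: gmetric_metrizable (subG_gmetric _ (prod_gmetric gd)). Qed.

Let co i (x : invlim X) : X i := subG_val x i.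

Let co_bond i j (ij : (i <= j)%N) x : bond X ij (co j x) = co i x.
Proof. exact/esym/(subG_valP x). Qed.

Let bond_irr i j (p q : (i <= j)%N) x : bond X p x = bond X q x.
Proof. by rewrite (bool_irrelevance p q). Qed.

Let co_gmap i : gmap (@co i) := @invlim_coord_gmap G X i.

(* The cover at level [i] has small images at all the earlier levels, so that
   the approximate lifts below are Cauchy at every level. *)
Let fineness i : set (set (X i)) := [set A | open A /\
  forall k (ki : (k <= i)%N) x y, A x -> A y ->
    d (bond X ki x) (bond X ki y) <= 2^-1 ^+ i].

Let fineness_cover i x : exists2 A, @fineness i A & A x.
Proof.
have e0 : 0 < (2^-1 ^+ i) / 2 :> R by rewrite divr_gt0 ?half_gt0.
(* Half the allowed diameter, since two points are compared through [x]. The bound [k < i.+1]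
   repeats [k <= i] in the form of [near_forall_ltn]. *)
pose A := [set y : X i | forall k, (k < i.+1)%N -> forall ki : (k <= i)%N,
  d (bond X ki x) (bond X ki y) < (2^-1 ^+ i) / 2].
exists A°; last first.
  apply: (@near_forall_ltn _ (nbhs x) (fun k y => forall ki : (k <= i)%N,
    d (bond X ki x) (bond X ki y) < (2^-1 ^+ i) / 2)) => k.
  have [ki|nki] := pselect (k <= i)%N; last first.
    by apply: nearW => y ki; case: nki.
  have nx : nbhs x (fun y => d (bond X ki x) (bond X ki y) < (2^-1 ^+ i) / 2).
    exact: ((bond_gmap X ki).1 x _ (gmetric_near (gd k) _ e0)).
  by apply: filterS nx => y h ki'; rewrite !(bond_irr ki' ki).
split; first exact: open_interior.
move=> k ki y z /interior_subset /(_ k ki ki) h1 /interior_subset /(_ k ki ki) h2.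
have := gm_tri (gd k) (bond X ki x) (bond X ki y) (bond X ki z).
by rewrite (gm_sym (gd k) _ (bond X ki x)); lra.
Qed.

(** The group acts by isometries that commute with the bonding maps. Homotopy extension asks this of
    its cover. *)
Let fineness_inv i (g : G) A : @fineness i A ->
  exists2 A', @fineness i A' & forall y, A y -> A' (gact g y).
Proof.
move=> [oA hA]; exists (gact (g^-1)%g @^-1` A); last by move=> y; rewrite /= gactK.
split; first by move/continuousP: (@gact_cts G (X i) (g^-1)%g); exact.
move=> k ki x y Ax Ay; have := hA k ki _ _ Ax Ay.
by rewrite !(bond_gmap X ki).2 (gm_inv (gd k)).
Qed.

Context (Z : gspaceType G) (dZ : Z -> Z -> R) (gZ : gmetric dZ).
Context (e : invlim X -> Z) (emb_e : closed_gembedding e).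

(** Exact on the embedded limit; only the compatibility of [s] with the maps at other levels will be
    approximate. *)
Let approx i (s : Z -> X i) := gmap s /\ forall x, s (e x) = co i x.

(** Homotopy extension is applied to [phi \o s], with the cover pulled back along [p]. One
    [2^-1 ^+ i] compares [p \o s'] with [p \o phi \o s], the other compares the latter with [s]. *)
Lemma approx_step i (s : Z -> X i) : approx s -> exists s' : Z -> X i.+1,
  approx s' /\ forall z k (ki : (k <= i)%N),
    d (bond X ki (s z)) (bond X (leqW ki) (s' z)) <= 2 * 2^-1 ^+ i.
Proof.
move=> [gs sE]; have [gp fine] := fineX i; set p := bond X (leqnSn i) in gp fine.
have [|phi [gphi [F [hF trackF F0 F1]] [F' [_ trackF' F'0 F'1]]]] := fine (@fineness i).
  split=> [A []//|]; apply/seteqP; split=> // x _.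
  by have [A fA Ax] := fineness_cover x; exists A.
pose h (q : invlim X * set_type (@unit_itv R)) := F (co i.+1 q.1, q.2).
have hh : ghomotopy h.
  split=> [q|g x t]; last by rewrite /h /= (co_gmap i.+1).2 hF.2.
  apply: (@continuous_comp _ _ _ (fun q : invlim X * _ => (co i.+1 q.1, q.2)) F).
    move=> A [[P Q] /= [nP nQ] PQ]; exists (@co i.+1 @^-1` P, Q).
      by split=> //; exact: ((co_gmap i.+1).1 _ _ nP).
    by move=> [x t] /= [Px Qt]; apply: PQ.
  exact: hF.1.
have gphis : gmap (phi \o s).
  split=> [z|g z]; last by rewrite /= gs.2 gphi.2.
  by apply: continuous_comp; [exact: gs.1|exact: gphi.1].
have [] := @homotopy_extension R G (invlim X) (X i.+1) Z _ (gd i.+1) _ gZ (anrX i.+1)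
  e emb_e (phi \o s) gphis h hh _ (preimage_cover p (@fineness i)).
- by move=> x; rewrite /h F0 /= sE -(co_bond (leqnSn i)).
- by move=> _ [A [oA _] <-]; move/continuousP: gp.1; exact.
- move=> y; have [A fA Ay] := fineness_cover (p y).
  by exists (p @^-1` A) => //; exists A.
- move=> g _ [A fA <-]; have [A' fA' AA'] := fineness_inv g fA.
  exists (p @^-1` A'); first by exists A'.
  by move=> y /AA'; rewrite /= gp.2.
- by move=> x; have [A WA hA] := trackF (co i.+1 x); exists A.
move=> s' [gs' s'E near]; exists s'; split; first by split=> // x; rewrite s'E /h F1.
move=> z k ki; have [_ [[A [_ hA] <-] A1 A2]] := near z.
have [A' [_ hA'] tr] := trackF' (s z).
have A'1 : A' (p (phi (s z))) by have := tr (unit_itv0 R); rewrite F'0.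
have A'2 : A' (s z) by have := tr (unit_itv1 R); rewrite F'1.
have -> : bond X (leqW ki) (s' z) = bond X ki (p (s' z)).
  by rewrite /p bond_comp; exact: bond_irr.
have h1 := hA k ki (p (phi (s z))) (p (s' z)) A1 A2.
have h2 := hA' k ki (s z) (p (phi (s z))) A'2 A'1.
have := gm_tri (gd k) (bond X ki (p (phi (s z)))) (bond X ki (s z))
  (bond X ki (p (s' z))).
by lra.
Qed.

Lemma invlim_retraction (s0 : Z -> X 0%N) : gmap s0 ->
  (forall x, s0 (e x) = subG_val x 0%N) ->
  exists r : Z -> invlim X, gmap r /\ forall x, r (e x) = x.
Proof.
move=> gs0 s0E.
(* The recursion carries the proof of [approx], which each step consumes. *)
pose next i (s : {s : Z -> X i | approx s}) : {s : Z -> X i.+1 | approx s} :=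
  let c := cid (approx_step (projT2 s)) in exist _ (projT1 c) (projT2 c).1.
pose S : forall i, {s : Z -> X i | approx s} :=
  nat_rect _ (exist _ s0 (conj gs0 s0E)) next.
pose s i : Z -> X i := projT1 (S i).
have sA i : approx (s i) := projT2 (S i).
have step i z k (ki : (k <= i)%N) :
    d (bond X ki (s i z)) (bond X (leqW ki) (s i.+1 z)) <= 2 * 2^-1 ^+ i.
  exact: (projT2 (cid (approx_step (projT2 (S i))))).2.
pose u k z n : X k := bond X (leq_addl n k) (s (n + k)%N z).
have u_step k z n : d (u k z n) (u k z n.+1) <= 2 * 2^-1 ^+ n.
  rewrite /u (bond_irr (leq_addl n.+1 k) (leqW (leq_addl n k))).
  apply: le_trans (step _ _ _ _) _; rewrite ler_wpM2l//.
  exact: half_anti (leq_addr _ _).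
(* Steps of size [2 * 2^-1 ^+ m] for [m] from [n] on sum to [4 * 2^-1 ^+ n]; subtracting the
   remaining tail lets the induction close. *)
have u_tele k z n j :
    d (u k z n) (u k z (j + n)%N) <= 4 * 2^-1 ^+ n - 4 * 2^-1 ^+ (j + n)%N.
  elim: j => [|j IH]; first by rewrite (gm_xx (gd k)) subrr.
  apply: le_trans (gm_tri (gd k) (u k z (j + n)%N) _ _) _.
  by have := u_step k z (j + n)%N; rewrite addSn exprS; lra.
have u_cauchy k z n m : (n <= m)%N -> d (u k z n) (u k z m) <= 4 * 2^-1 ^+ n.
  move=> /subnK <-; apply: le_trans (u_tele _ _ _ _) _.
  by have := half_gt0 R ((m - n) + n)%N; lra.
have u_cvg k z : exists x : X k, u k z @ \oo --> x.
  apply: complete_d => c c0; have [|N hN] := @half_lt R (c / 8); first lra.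
  exists N => a b Na Nb; have := u_cauchy k z _ _ Na; have := u_cauchy k z _ _ Nb.
  by have := gm_tri (gd k) (u k z N) (u k z a) (u k z b); rewrite (gm_sym (gd k) _ (u k z N)); lra.
pose r k z : X k := projT1 (cid (u_cvg k z)).
have u_r k z n : d (u k z n) (r k z) <= 4 * 2^-1 ^+ n.
  apply/ler_addgt0Pl => c c0.
  have /= [N _ hN] := projT2 (cid (u_cvg k z)) _ (gmetric_near (gd k) (r k z) c0).
  have := hN (maxn n N) (leq_maxr _ _); have := u_cauchy k z _ _ (leq_maxl n N).
  have := gm_tri (gd k) (u k z (maxn n N)) (u k z n) (r k z).
  by rewrite /= (gm_sym (gd k) (r k z)); lra.
have s_r k j (kj : (k <= j)%N) z :
    d (bond X kj (s j z)) (r k z) <= 4 * 2^-1 ^+ (j - k)%N.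
  have [n jE] : exists n, j = (n + k)%N by exists (j - k)%N; rewrite subnK.
  subst j; rewrite addnK (bond_irr kj (leq_addl n k)); exact: u_r.
have eq_small k (x y : X k) (C : R) :
    (forall n, d x y <= C * 2^-1 ^+ n) -> x = y.
  move=> h; apply: (gm_eq (gd k)); apply/eqP; rewrite eq_le (gm_ge0 (gd k)) andbT.
  apply/ler_addgt0Pl => c c0; rewrite addr0.
  have C0 : 0 <= C by have := h 0%N; rewrite expr0 mulr1; apply: le_trans; exact: (gm_ge0 (gd k)).
  have [|n hn] := @half_lt R (c / (C + 1)); first by rewrite divr_gt0//; lra.
  move: hn; rewrite ltr_pdivlMr; last by lra.
  by have := h n; have := half_gt0 R n; nra.
have u_gmap k n : gmap (u k ^~ n).
  split=> [z|g z]; last by rewrite /u (sA _).1.2 (bond_gmap X _).2.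
  apply: continuous_comp; first exact: (sA _).1.1.
  exact: (bond_gmap X _).1.
(* The bound [u_r] is uniform in [z], so [r k] is a uniform limit of continuous maps. *)
have r_cts k : continuous (r k).
  move=> z A /(gm_nbhs (gd k)) [c c0 cA].
  have [|n hn] := @half_lt R (c / 16); first lra.
  have c2 : 0 < c / 2 by lra.
  have nz : nbhs z (fun w => d (u k z n) (u k w n) < c / 2).
    exact: ((u_gmap k n).1 z _ (gmetric_near (gd k) (u k z n) c2)).
  apply: (filterS _ nz) => w /= uw; apply: cA.
  have := gm_tri (gd k) (u k z n) (r k z) (r k w).
  have := gm_tri (gd k) (u k w n) (u k z n) (r k w).
  by rewrite (gm_sym (gd k) (r k z) (u k z n)); have := u_r k z n; have := u_r k w n; lra.
have r_eq k (g : G) z : r k (gact g z) = gact g (r k z).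
  apply: (eq_small _ _ _ 8) => n.
  have := gm_tri (gd k) (gact g (u k z n)) (r k (gact g z)) (gact g (r k z)).
  rewrite (gm_inv (gd k)) (gm_sym (gd k) (r k (gact g z)) (gact g (u k z n))).
  by have := u_r k z n; have := u_r k (gact g z) n; rewrite (u_gmap k n).2; lra.
have r_thread z : threads (X := X) (fun i => r i z).
  move=> i j ij /=; apply/esym; apply: (gm_eq (gd i)); apply/eqP.
  rewrite eq_le (gm_ge0 (gd i)) andbT; apply/ler_addgt0Pl => c c0; rewrite addr0.
  have c2 : 0 < c / 2 by lra.
  (* The bonding map is only known to be continuous, so its modulus [c'] at [r j z] is fixed first;
     [n] then makes the approximation fine enough at both levels. *)
  have /(gm_nbhs (gd j)) [c' c'0 hc'] :=
    (bond_gmap X ij).1 (r j z) _ (gmetric_near (gd i) _ c2).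
  have [|n hn] := @half_lt R (Num.min (c / 8) (c' / 4)); first by rewrite lt_min !divr_gt0.
  move: hn; rewrite lt_min => /andP[n1 n2].
  have h1 : d (bond X ij (r j z)) (bond X ij (u j z n)) < c / 2.
    by apply: hc'; rewrite (gm_sym (gd j)); have := u_r j z n; lra.
  have h2 := s_r i (n + j)%N (leq_trans ij (leq_addl n j)) z.
  rewrite -bond_comp -/(u j z n) in h2.
  have h3 : 2^-1 ^+ (n + j - i)%N <= 2^-1 ^+ n :> R.
    by apply: half_anti; rewrite -addnBA// leq_addr.
  by have := gm_tri (gd i) (bond X ij (u j z n)) (bond X ij (r j z)) (r i z); lra.
pose rr z : invlim X := toSub (threads_invariant (X := X)) (r_thread z).
exists rr; split.
  split=> [|g z]; first by apply: subG_cts; apply: prod_cts.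
  apply: subG_val_inj; apply: functional_extensionality_dep => i; exact: r_eq.
(* On the embedded limit the sequence [u k] is constant, equal to the projection. *)
move=> x; apply: subG_val_inj; apply: functional_extensionality_dep => k.
apply/esym; apply: (eq_small k _ _ 4) => n.
by have := u_r k (e x) n; rewrite /u (sA _).2 co_bond.
Qed.

End limit.

(** * Closed embeddings and maps given on their images *)

Lemma toSub_closed_gembedding (G : topGroupType) (A Z : gspaceType G)
    (e : A -> Z) (N : set Z) (iN : Defs.invariant N) (eN : forall x, N (e x)) :
  closed_gembedding e -> closed_gembedding (fun x => toSub iN (eN x)).
Proof.
move=> [[ce ee] inj topA cl].
have cts : continuous (fun x => toSub iN (eN x)) by apply: subG_cts.
split.
- by split=> // g x; apply: subG_val_inj; exact: ee.
- by move=> x y /(congr1 (@subG_val _ _ _ _)) /inj.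
- apply/seteqP; split=> [U|_ [V oV <-]]; last by move/continuousP: cts; exact.
  rewrite topA => -[V oV <-]; exists (@subG_val _ _ _ iN @^-1` V) => //.
  by move/continuousP: (@subG_val_continuous G Z N iN); exact.
- have -> : range (fun x => toSub iN (eN x)) = @subG_val _ _ _ iN @^-1` range e.
    apply/seteqP; split=> [_ [x _ <-]|u [x _ xu]]; first by exists x.
    by exists x => //; exact: subG_val_inj.
  by apply: preimage_closed => // u _; exact: subG_val_continuous.
Qed.

Section partial_map.
Context (G : topGroupType) (A Y Z : gspaceType G).
Context (e : A -> Z) (emb_e : closed_gembedding e) (p : A -> Y) (gp : gmap p).
Context (y0 : Z -> Y).

(** The values of [y0] are mere defaults, with no continuity asked of them. *)
Definition extend_by (z : Z) : Y :=
  match pselect (exists a, e a = z) with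
  | left ea => p (projT1 (cid ea))
  | right _ => y0 z
  end.

Lemma extend_byE a : extend_by (e a) = p a.
Proof.
rewrite /extend_by; case: pselect => [ea|]; last by case; exists a.
by case: cid => b /= be; congr p; case: emb_e => _ inj _ _; exact: inj.
Qed.

Lemma extend_by_cts : continuous_on (range e) extend_by.
Proof.
move=> _ [a _ <-] V; rewrite extend_byE => nV.
have := gp.1 a V nV; rewrite /= nbhsE => -[U [+ Ua] UV].
case: emb_e => _ _ -> _ [E oE EU].
have nE : nbhs (e a) E by apply: open_nbhs_nbhs; split=> //; move: Ua; rewrite -EU.
apply: filterS nE => z Ez [b _ bz]; rewrite -bz extend_byE.
by apply: UV; rewrite -EU /= bz.
Qed.

Lemma range_invariant : Defs.invariant (range e).
Proof. by case: emb_e => -[_ ee] _ _ _ g _ [a _ <-]; exists (gact g a). Qed.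

Lemma extend_by_act (g : G) z :
  range e z -> extend_by (gact g z) = gact g (extend_by z).
Proof.
by move=> [a _ <-]; case: emb_e => -[_ ee] _ _ _; rewrite -ee !extend_byE gp.2.
Qed.

End partial_map.

(** For an empty [G]-AR this embedding yields a map from [Z] to it, which serves as default
    function. *)
Lemma empty_closed_gembedding (G : topGroupType) (Y Z : gspaceType G) (e : Y -> Z) :
  (Y -> False) -> closed_gembedding e.
Proof.
move=> nY; split; [by split=> [y|g y]; have := nY y|by move=> y; have := nY y| |].
  have eqY (U V : set Y) : U = V by apply/seteqP; split=> y; have := nY y.
  apply/seteqP; split=> [U oU|_ [V oV <-]]; first by exists set0; [exact: open0|exact: eqY].
  by rewrite (eqY (e @^-1` V) set0); exact: open0.
rewrite (_ : range e = set0); first exact: closed0.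
by apply/seteqP; split=> // z [y _ _]; have := nY y.
Qed.

Theorem theorem6p1 (R : realType) (G : topGroupType)
    (cptG : compact [set: G]) (hausG : hausdorff_space G)
    (X : inverse_sequence G)
    (cmX : forall i : nat, completely_metrizable R (X i))
    (anrX : forall i : nat, G_ANR R (X i))
    (fineX : forall i : nat,
       fine_ghomotopy_equivalence R (bond X (leqnSn i))) :
  G_ANR R (invlim X) /\
  ((forall i : nat, G_AR R (X i)) -> G_AR R (invlim X)).
Proof.
have mX := invlim_metrizable cptG cmX.
have gp0 : gmap (fun x : invlim X => subG_val x 0%N) by exact: invlim_coord_gmap.
have [d0 gd0] := metrizable_gmetric cptG (anrX 0).1.
split; [|move=> arX]; split=> // Z e mZ emb_e; have [d gd] := metrizable_gmetric cptG mZ;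
  have cl_e : closed (range e) by case: emb_e.
  (* The extension needs a default value in [X 0]. If there is none, the limit is empty and the
     empty neighborhood will do. *)
  have [[y0]|nX0] := pselect (inhabited (X 0%N)); last first.
    have nX (x : invlim X) : False by apply: nX0; exists; exact: (subG_val x 0%N).
    have iN : @Defs.invariant G Z set0 by [].
    have nN (u : subG iN) : False := subG_valP u.
    exists set0, iN, (fun u => False_rect _ (nN u)); split.
    - by move=> z [x _ _]; have := nX x.
    - by split=> [u|g u]; have := nN u.
    - by move=> x; have := nX x.
  have [N [iN [r [oN eN gr rE]]]] := G_ANR_extension gd0 gd cl_e
    (range_invariant emb_e) (@extend_by_cts _ _ _ _ _ emb_e _ gp0 (fun=> y0))
    (@extend_by_act _ _ _ _ _ emb_e _ gp0 (fun=> y0)) (anrX 0).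
  have Ne x : N (e x) by apply: eN; exists x.
  (* The open invariant set [N] becomes the ambient space, so that [r] is a globally defined start
     of the recursion. *)
  have [|rho [grho rhoE]] := invlim_retraction cptG cmX anrX fineX
    (subG_gmetric iN gd) (toSub_closed_gembedding iN Ne emb_e) gr.
    by move=> x; rewrite rE; [exact: extend_byE|exists x].
  exists N, iN, rho; split=> //; first by rewrite ((interior_id N).1 oN).
  by move=> x u ux; rewrite -[RHS]rhoE; congr rho; exact: subG_val_inj.
(* Here [r] must be defined on all of [Z]; if [X 0] is empty, its [G]-AR property itself provides
   the default function. *)
have [y0 _] : exists y0 : Z -> X 0%N, True.
  have [[y0]|nX0] := pselect (inhabited (X 0%N)); first by exists (fun=> y0).
  pose i (x : X 0%N) : Z := False_rect _ (nX0 (inhabits x)).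
  have emb_i := empty_closed_gembedding i (fun x => nX0 (inhabits x)).
  by have [r _] := (arX 0).2 Z i mZ emb_i; exists r.
have [r [gr rE]] := G_AR_extension gd0 gd cl_e
  (range_invariant emb_e) (@extend_by_cts _ _ _ _ _ emb_e _ gp0 y0)
  (@extend_by_act _ _ _ _ _ emb_e _ gp0 y0) (arX 0).
have [|rho rhoP] := invlim_retraction cptG cmX anrX fineX gd emb_e gr.
  by move=> x; rewrite rE; [exact: extend_byE|exists x].
by exists rho.
Qed.
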